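(* Let $0<\delta,\lambda<1$. (A) Let $\bar\alpha\in\Delta^n$ satisfy $q_{\bar\alpha}(\beta,x)\le h(\bar\alpha)$ for every $\beta\in\Delta^n$ and every $x\in z^*(\beta)$. Then every stationary randomized MPE starting at $\alpha_0=\bar\alpha$ satisfies, with probability one, simultaneously for all $t\ge1$, $$q_{\bar\alpha}(\alpha_t,x_t)=h(\bar\alpha),\qquad\alpha_t\in K(\bar\alpha).$$ If $K(\bar\alpha)\cap\mathcal P=\varnothing$, then $\varepsilon:=\operatorname{dist}(K(\bar\alpha),\mathcal P)>0$ and almost surely $\operatorname{dist}(\alpha_t,\mathcal P)\ge\varepsilon$ for every $t\ge1$. (B) Let $J=\{1,2\}$, $X=\{c,a,b\}$, $u_1(c)=0,u_1(a)=1,u_1(b)=-3$, $u_2(c)=0,u_2(a)=-3,u_2(b)=1$, and identify a worldview with its weight $\alpha\in[0,1]$ on worldview 1. A stationary randomized MPE exists for every $\delta,\lambda\in(0,1)$. Starting from $\alpha_0=1/2$: (i) if $0<\lambda<1/2$, in every stationary randomized MPE, almost surely $\alpha_1\in\{0,1\}$ and $\alpha_t=\alpha_1$ for all $t\ge1$; (ii) if $\lambda=1/2$, there is a stationary randomized MPE for which $\alpha_t$ almost surely converges to a pure worldview and one for which it almost surely does not, and in every stationary randomized MPE, almost surely $(\alpha_t,x_t)\in\{(\beta,c):\beta\in[1/4,3/4]\}\cup\{(1,a),(0,b)\}$ for all $t\ge1$; (iii) if $1/2<\lambda<1$, in every stationary randomized MPE, almost surely $x_t=c$ and $\alpha_t\in[1/4,3/4]$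 for all $t\ge0$; in particular, in the usual distance on $[0,1]$, almost surely $\operatorname{dist}(\alpha_t,\{0,1\})\ge1/4$ for all $t$. (C) Let $n\ge2$, $M>1/(n-1)$, $J=\{1,\ldots,n\}$, $X=\{c,a_1,\ldots,a_n\}$, $u_j(c)=0$, $u_j(a_i)=1$ if $j=i$ and $-M$ if $j\ne i$. Put $\bar\alpha=(1/n,\ldots,1/n)$, $\lambda_c=\frac{n}{(n-1)(1+M)}$, $C_c=\{\alpha\in\Delta^n:\alpha^i\le\frac{M}{1+M}\ \forall i\}$. A stationary randomized MPE exists for every $\delta,\lambda\in(0,1)$, and in every such equilibrium every pure worldview is absorbing ($\kappa_{\alpha(j)}(\{\alpha(j)\})=1$). Starting at $\bar\alpha$: (i) if $\lambda<\lambda_c$, in every stationary randomized MPE, almost surely $\alpha_1\in\mathcal P$ and $\alpha_t=\alpha_1$ for all $t\ge1$; (ii) if $\lambda>\lambda_c$, in every stationary randomized MPE, almost surely $x_t=c$, $\alpha_t\in C_c$ and $\operatorname{dist}_1(\alpha_t,\mathcal P)\ge\frac{2}{1+M}$ for all $t\ge0$, and the same holds from every initial state in the nonempty relatively open set $\mathcal T_\lambda=\{\alpha\in\Delta^n:\max_i\alpha^i<1-\frac1{\lambda(1+M)}\}$; (iii) if $\lambda=\lambda_c$, there is a stationary randomized MPE for which, from $\bar\alpha$, almost surely $\alpha_1$ is pure and $\alpha_t=\alpha_1$ for all $t\ge1$, and one for which almost surely $\alpha_1$ is mixed (non-pure) and $\alpha_t=\alpha_1$ for all $t\ge1$.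
   Context: $J=\{1,\ldots,n\}$ and $X$ are nonempty finite sets (pure worldviews and actions) with payoffs $u_j(x)\in\mathbb R$ (arbitrary in part (A)). $\Delta^n=\{\alpha\in\mathbb R^n:\alpha^j\ge0,\ \sum_j\alpha^j=1\}$; $\alpha(j)$ is the vertex with weight one on $j$; $\mathcal P=\{\alpha(1),\ldots,\alpha(n)\}$. $U(\alpha,x)=\sum_j\alpha^ju_j(x)$, $z^*(\alpha)=\arg\max_{x\in X}U(\alpha,x)$, $h(\alpha)=\max_{x\in X}U(\alpha,x)$. Distances in $\Delta^n$ ($\operatorname{dist}=\operatorname{dist}_1$) are in the $\ell^1$ norm. Define $$q_{\bar\alpha}(\beta,x)=(1-\lambda)U(\beta,x)+\lambda U(\bar\alpha,x),\qquad K(\bar\alpha)=\{\beta\in\Delta^n:\exists x\in z^*(\beta)\text{ with }q_{\bar\alpha}(\beta,x)=h(\bar\alpha)\}.$$ A stationary randomized strategy is a Borel probability kernel $\alpha\mapsto\Pi_\alpha$ from $\Delta^n$ to $X\times\Delta^n$, with marginals $s_\alpha$ on $X$ and $\kappa_\alpha$ on $\Delta^n$. From a fixed $\alpha_0$, conditional on the history $(\alpha_0,x_0,\ldots,x_{t-1},\alpha_t)$, the pair $(x_t,\alpha_{t+1})$ has law $\Pi_{\alpha_t}$; $\mathbb E_\beta$ is expectation when $\alpha_0=\beta$. Put $$C_\Pi(\beta;\alpha)=\mathbb E_\beta\sum_{k=0}^\infty\delta^k\big[(1-\lambda)U(\alpha_k,x_k)+\lambda U(\alpha,x_k)\big],\qquad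 S(\alpha)=\int C_\Pi(\beta;\alpha)\,\kappa_\alpha(d\beta).$$ $\Pi$ is a stationary randomized MPE if for every $\alpha\in\Delta^n$: $s_\alpha(z^*(\alpha))=1$ and $S(\alpha)\ge C_\Pi(\gamma;\alpha)$ for every $\gamma\in\Delta^n$. *)

(* Defs.v *)
From HB Require Import structures.
From mathcomp Require Import all_boot all_order all_algebra.
From mathcomp Require Import all_classical all_reals all_analysis.
From mathcomp Require Import measurable_realfun.
Set Implicit Arguments.
Unset Strict Implicit.
Unset Printing Implicit Defensive.
Import Order.TTheory GRing.Theory Num.Theory.
Import numFieldNormedType.Exports.
Local Open Scope classical_set_scope.
Local Open Scope ring_scope.

(* Sample paths: infinite sequences of outcomes, with the product sigma-algebra. *)
Definition traj (S : Type) : Type := nat -> S.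

Section traj_measurable.
Context d (S : measurableType d).

Definition coord_sets (I : set nat) : set (set (traj S)) :=
  [set A | exists i B, [/\ I i, measurable B & A = [set w | B (w i)]]].

(* sigma-algebra generated by the outcomes of periods 0, ..., t - 1 *)
Definition history t : set (set (traj S)) := <<s coord_sets `I_t >>.

HB.instance Definition _ := Pointed.on (traj S).
HB.instance Definition _ := @isMeasurable.Build (sigma_display (coord_sets setT))
  (traj S) <<s coord_sets setT >> (@sigma_algebra0 _ setT _)
  (@sigma_algebraC (traj S) _) (@sigma_algebra_bigcup _ setT _).

Lemma measurable_coord i : measurable_fun setT (fun w : traj S => w i).
Proof.
by move=> _ B mB; rewrite setTI; apply: sub_sigma_algebra; exists i, B.
Qed.

Lemma measurable_trajP d' (T : measurableType d') (f : T -> traj S) :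
  (forall i, measurable_fun setT (fun x => f x i)) -> measurable_fun setT f.
Proof.
move=> mf; apply: (@measurability _ _ _ _ _ _ (coord_sets setT)) => //.
move=> _ [_ [i [B [_ mB ->]]] <-].
exact: mf.
Qed.

Lemma history_measurable t A : history t A -> measurable A.
Proof.
apply: sub_sigma_algebra2.
move=> _ [i [B [_ mB ->]]].
by exists i, B.
Qed.

Definition dep (m : nat) (A : set (traj S)) :=
  forall w w' : traj S, (forall i, (i < m)%N -> w i = w' i) -> A w -> A w'.

Lemma history_dep t A : history t A -> dep t A.
Proof.
move: A; apply: smallest_sub; last first.
  move=> _ [i [B [/= it mB ->]]] w w' ww' /=.
  by rewrite ww'.
split.
- by move=> w w'.
- move=> A dA w w' ww' [_ nA]; split => // Aw'; apply: nA.
  by apply: dA Aw' => i im; rewrite ww'.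
- by move=> F dF w w' ww' [n _ Fn]; exists n => //; exact: dF Fn.
Qed.

Definition upd (w : traj S) (k : nat) (y : S) : traj S :=
  fun i => if i == k then y else w i.

Lemma measurable_upd k :
  measurable_fun setT (fun wy : traj S * S => upd wy.1 k wy.2).
Proof.
apply: measurable_trajP => i; rewrite /upd; case: eqP => _.
  exact: measurable_snd.
apply: (measurableT_comp (measurable_coord i)); exact: measurable_fst.
Qed.

Lemma measurable_upd2 w k : measurable_fun setT (upd w k).
Proof.
apply: measurable_trajP => i; rewrite /upd; case: eqP => _ //.
Qed.

End traj_measurable.

(* P is the law of a sequence of outcomes w 0, w 1, ... such that, conditionally
   on w 0, ..., w (t - 1), the outcome w t has law Pi (st t w). *)
Definition conditional_law d (S : measurableType d) d' (Y : measurableType d')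
    (R : realType) (Pi : R.-pker Y ~> S) (st : nat -> traj S -> Y)
    (P : probability (traj S) R) : Prop :=
  forall t H B, history t H -> measurable B ->
    P (H `&` [set w | B (w t)]) = (\int[P]_(w in H) Pi (st t w) B)%E.

(* Ionescu-Tulcea: such a law exists. Sets depending on the first m outcomes are
   the sets satisfying dep m; pth m k w is the law of the path that follows w
   before period k and is drawn from the kernels in periods k, ..., k + m - 1. *)
Section ionescu_tulcea.
Context d (S : measurableType d) d' (Y : measurableType d') (R : realType).
Context (Pi : R.-pker Y ~> S) (st : nat -> traj S -> Y).
Context (mst : forall t, measurable_fun setT (st t)).
Context (dst : forall t (w w' : traj S), (forall i, (i < t)%N -> w i = w' i) ->
  st t w = st t w').
Local Open Scope ereal_scope.

Definition stepk (k : nat) (w : traj S) : {measure set S -> \bar R} :=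
  Pi (st k w).

Lemma measurable_stepk k U : measurable U ->
  measurable_fun [set: traj S] (stepk k ^~ U).
Proof.
by move=> mU; exact: (measurableT_comp (measurable_kernel Pi U mU) (mst k)).
Qed.

HB.instance Definition _ k :=
  isKernel.Build _ _ _ _ R (stepk k) (@measurable_stepk k).
HB.instance Definition _ k :=
  Kernel_isProbability.Build _ _ _ _ R (stepk k) (fun w => prob_kernel (st k w)).

Definition updk (K : R.-pker (traj S) ~> (traj S)) k (wy : traj S * S) :
  {measure set (traj S) -> \bar R} := K (upd wy.1 k wy.2).

Lemma measurable_updk K k U : measurable U ->
  measurable_fun [set: traj S * S] (updk K k ^~ U).
Proof.
by move=> mU; exact: (measurableT_comp (measurable_kernel K U mU) (measurable_upd k)).
Qed.

HB.instance Definition _ K k :=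
  isKernel.Build _ _ _ _ R (updk K k) (@measurable_updk K k).
HB.instance Definition _ K k := Kernel_isProbability.Build _ _ _ _ R (updk K k)
  (fun wy => prob_kernel (upd wy.1 k wy.2)).

Definition kstep (K : R.-pker (traj S) ~> (traj S)) k :
  traj S -> {measure set (traj S) -> \bar R} := mkcomp (stepk k) (updk K k).

Lemma measurable_kstep K k U : measurable U ->
  measurable_fun [set: traj S] (kstep K k ^~ U).
Proof.
by move=> mU; exact: (measurable_kernel (mkcomp (stepk k) (updk K k)) U mU).
Qed.

Lemma kstepT K k w : kstep K k w setT = 1.
Proof.
rewrite /kstep /mkcomp /= /kcomp.
under eq_integral do rewrite prob_kernel.
by rewrite integral_cst// mul1e prob_kernel.
Qed.

HB.instance Definition _ K k :=
  isKernel.Build _ _ _ _ R (kstep K k) (@measurable_kstep K k).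
HB.instance Definition _ K k := Kernel_isProbability.Build _ _ _ _ R (kstep K k)
  (@kstepT K k).

Fixpoint pth (m k : nat) : R.-pker (traj S) ~> (traj S) :=
  if m is m'.+1 then kstep (pth m' k.+1) k
  else kdirac (@measurable_id _ (traj S) setT).

Lemma pth0E k A w : pth 0 k w A = (\1_A w)%:E.
Proof. by []. Qed.

Lemma pthSE m k A w : pth m.+1 k w A = \int[stepk k w]_y pth m k.+1 (upd w k y) A.
Proof. by []. Qed.

Lemma pth_le1 m k A w : measurable A -> pth m k w A <= 1.
Proof.
move=> mA; rewrite -(@prob_kernel _ _ _ _ _ (pth m k) w).
by apply: le_measure; rewrite ?inE.
Qed.

Lemma integral_pth_last m k w (f : traj S -> \bar R) :
  (forall z, 0 <= f z) -> measurable_fun setT f ->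
  \int[pth m.+1 k w]_z f z =
  \int[pth m k w]_v \int[stepk (k + m) v]_y f (upd v (k + m) y).
Proof.
move=> f0 mf.
have mF j : measurable_fun setT (fun v : traj S => \int[stepk j v]_y f (upd v j y)).
  apply: (measurable_fun_integral_finite_kernel
    (fun wy : traj S * S => f (upd wy.1 j wy.2)) (stepk j)) => //.
  by apply: (measurableT_comp mf); exact: measurable_upd.
have F0 j v : 0 <= \int[stepk j v]_y f (upd v j y) by exact: integral_ge0.
elim: m k w => [|m IH] k w.
  rewrite addn0 [RHS]integral_dirac// diracT mul1e.
  rewrite [LHS](@integral_kcomp _ _ _ _ _ _ _ (stepk k) (updk (pth 0 k.+1) k))//.
  by apply: eq_integral => y _; rewrite [LHS]integral_dirac// diracT mul1e.
rewrite [LHS](@integral_kcomp _ _ _ _ _ _ _ (stepk k) (updk (pth m.+1 k.+1) k))//.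
rewrite [RHS](@integral_kcomp _ _ _ _ _ _ _ (stepk k) (updk (pth m k.+1) k))//.
apply: eq_integral => y _.
by rewrite [LHS]IH addSnnS.
Qed.

Lemma dep_indic m (A : set (traj S)) (w w' : traj S) :
  dep m A -> (forall i, (i < m)%N -> w i = w' i) -> \1_A w = \1_A w' :> R.
Proof.
move=> dA ww'; rewrite !indicE; congr (_ %:R); congr nat_of_bool.
apply/idP/idP => /set_mem wA; apply/mem_set; apply: dA wA => // i im.
by rewrite ww'.
Qed.

Lemma pth_stable1 m k (A : set (traj S)) w : dep (k + m) A ->
  pth m.+1 k w A = pth m k w A.
Proof.
elim: m k w => [|m IH] k w dA.
  rewrite pthSE (_ : (fun y => _) = cst (\1_A w)%:E).
    by rewrite integral_cst// prob_kernel mule1.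
  apply/funext => y; rewrite pth0E; congr (_%:E); apply: (dep_indic dA) => i.
  by rewrite addn0 /upd => ik; rewrite ltn_eqF.
rewrite [LHS]pthSE [RHS]pthSE; apply: eq_integral => y _.
by apply: IH; rewrite addSnnS.
Qed.

Lemma dep_le m n (A : set (traj S)) : (m <= n)%N -> dep m A -> dep n A.
Proof.
move=> mn dA w w' ww'; apply: dA => i im; apply: ww'; exact: leq_trans mn.
Qed.

Lemma pth_stable m n k (A : set (traj S)) w : dep (k + m) A -> (m <= n)%N ->
  pth n k w A = pth m k w A.
Proof.
move=> dA /subnK <-; elim: (n - m)%N => // j IH.
rewrite addSn pth_stable1//; apply: dep_le dA; rewrite leq_add2l; exact: leq_addl.
Qed.

Definition ext k (A : set (traj S)) (w : traj S) : \bar R :=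
  limn (fun m => pth m k w A).

Lemma extE m k (A : set (traj S)) w : dep (k + m) A -> ext k A w = pth m k w A.
Proof.
move=> dA; apply/cvg_lim => //; apply: cvg_near_cst.
by exists m => // n /= mn; exact: pth_stable.
Qed.

Lemma ext_step k (A : set (traj S)) w : (exists m, dep m A) ->
  ext k A w = \int[stepk k w]_y ext k.+1 A (upd w k y).
Proof.
move=> [m dA]; rewrite (@extE m.+1 k).
  rewrite pthSE; apply: eq_integral => y _; rewrite (@extE m) //.
  by apply: dep_le dA; rewrite leq_addl.
by apply: dep_le dA; rewrite addnS leqW// leq_addl.
Qed.

Definition cyl (A : set (traj S)) := measurable A /\ exists m, dep m A.

Lemma ext_ge0 k A w : cyl A -> 0 <= ext k A w.
Proof.
by case=> mA [m dA]; rewrite (@extE m)//; apply: dep_le dA; exact: leq_addl.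
Qed.

Lemma ext_le1 k A w : cyl A -> ext k A w <= 1.
Proof.
case=> mA [m dA]; rewrite (@extE m) ?pth_le1//.
by apply: dep_le dA; exact: leq_addl.
Qed.

Lemma cyl_measurable A : cyl A -> measurable A. Proof. by case. Qed.

Lemma ext_measurable k A : cyl A -> measurable_fun setT (ext k A).
Proof.
case=> mA [m dA]; rewrite (_ : ext k A = fun w => pth m k w A).
  exact: measurable_kernel.
by apply/funext => w; rewrite (@extE m)//; apply: dep_le dA; exact: leq_addl.
Qed.

Lemma le_ext k A B w : cyl A -> cyl B -> A `<=` B -> ext k A w <= ext k B w.
Proof.
case=> mA [m dA] [mB [n dB]] AB.
rewrite !(@extE (m + n)).
- by apply: le_measure; rewrite ?inE.
- by apply: dep_le dB; rewrite addnA leq_addl.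
- by apply: dep_le dA; rewrite addnCA leq_addr.
Qed.

Section empty.
Context (B : (set (traj S))^nat).
Context (cB : forall n, cyl (B n)).
Context (dB : forall n, B n.+1 `<=` B n).

Let g k w := limn (fun n => ext k (B n) w).

Let cvg_g k w : ext k (B n) w @[n --> \oo] --> g k w.
Proof.
apply: ereal_nonincreasing_is_cvgn; apply/nonincreasing_seqP => n.
exact: le_ext.
Qed.

Let g_ge0 k w : 0 <= g k w.
Proof.
by apply: lime_ge; [exact: cvg_g|apply: nearW => n; exact: ext_ge0].
Qed.

Let g_step k w : 0 < g k w -> exists y, 0 < g k.+1 (upd w k y).
Proof.
move=> gw; apply: contrapT => /forallNP ng.
have g0 y : g k.+1 (upd w k y) = 0.
  by apply/eqP; rewrite eq_le g_ge0 andbT leNgt; exact/negP/ng.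
pose f n (y : S) := ext k.+1 (B n) (upd w k y).
have [] := @dominated_convergence _ _ _ (stepk k w) setT measurableT f (cst 0) (cst 1).
- move=> n; apply: (measurableT_comp (ext_measurable _ (cB n))).
  exact: measurable_upd2.
- exact: measurable_cst.
- by apply: aeW => y _; rewrite -[cst 0 y](g0 y); exact: cvg_g.
- apply/integrableP; split; first exact: measurable_cst.
  under eq_integral do rewrite gee0_abs//.
  by rewrite integral_cst// prob_kernel mul1e ltry.
- apply: aeW => y n _; rewrite gee0_abs; last exact: ext_ge0.
  exact: ext_le1.
move=> _ _; rewrite integral0 => cf.
have : g k w = 0.
  apply/cvg_lim => //; apply: cvg_trans cf.
  by apply: near_eq_cvg; apply: nearW => n; rewrite ext_step//; case: (cB n).
by move=> gw0; move: gw; rewrite gw0 ltxx.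
Qed.

Lemma ext_empty w : \bigcap_n B n = set0 -> ext 0 (B n) w @[n --> \oo] --> 0.
Proof.
move=> B0.
suff : ~ (0 < g 0 w).
  move/negP; rewrite -leNgt => gw.
  have <- : g 0 w = 0 by apply/eqP; rewrite eq_le g_ge0 gw.
  exact: cvg_g.
move=> gw.
have /choice[F FP] : forall kw : nat * traj S, exists y,
    0 < g kw.1 kw.2 -> 0 < g kw.1.+1 (upd kw.2 kw.1 y).
  move=> [k v] /=; have [gv|ngv] := boolP (0 < g k v).
    by have [y ?] := g_step gv; exists y.
  by exists point.
pose fix W k := if k is k'.+1 then upd (W k') k' (F (k', W k')) else w.
have Wpos k : 0 < g k (W k) by elim: k => [//|k IH]; exact: (FP (k, W k)).
have Wst i k j : (i < k)%N -> W (k + j)%N i = W k i.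
  move=> ik; elim: j => [|j IH]; first by rewrite addn0.
  rewrite addnS /= /upd ltn_eqF// ltn_addr//.
pose v : traj S := fun i => W i.+1 i.
suff : (\bigcap_n B n) v by rewrite B0.
move=> n _; have [mBn [m dBn]] := cB n.
apply: (dBn (W m)).
  by move=> i im; rewrite /v -(subnKC im) Wst.
have dBB p : (n <= p)%N -> B p `<=` B n.
  elim: p => [|p IH]; first by rewrite leqn0 => /eqP ->.
  by rewrite leq_eqVlt => /predU1P[->//|]; rewrite ltnS => /IH h x /dB; exact: h.
have : 0 < ext m (B n) (W m).
  apply: lt_le_trans (Wpos m) _.
  apply: lime_le; first exact: cvg_g.
  exists n => // p /= np; apply: le_ext => //.
  exact: dBB.
rewrite (@extE 0) ?addn0// pth0E lte_fin indicE.
by case: (boolP (_ \in _)) => [/set_mem//|]; rewrite ltxx.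
Qed.

End empty.

Lemma cyl0 : cyl set0. Proof. by split=> //; exists 0%N. Qed.

Lemma cylU : setU_closed cyl.
Proof.
move=> A B [mA [m dA]] [mB [n dB]]; split; first exact: measurableU.
exists (m + n)%N => w w' ww' [Aw|Bw]; [left|right].
  by apply: dA Aw => i im; apply: ww'; rewrite ltn_addr.
by apply: dB Bw => i im; apply: ww'; rewrite ltn_addl.
Qed.

Lemma cylC : setC_closed cyl.
Proof.
move=> A [mA [m dA]]; split; first exact: measurableC.
exists m => w w' ww' nAw Aw'; apply: nAw; apply: dA Aw' => i im.
by rewrite ww'.
Qed.

Lemma cylD A B : cyl A -> cyl B -> cyl (A `\` B).
Proof.
move=> cA cB; rewrite setDE -(setCK A) -setCU; apply: cylC; apply: cylU => //.
exact: cylC.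
Qed.

Definition cylT := traj S.
HB.instance Definition _ := Pointed.on cylT.
HB.instance Definition _ :=
  @isAlgebraOfSets.Build default_measure_display cylT cyl cyl0 cylU cylC.

Context (w0 : traj S).
Definition mu0 : set cylT -> \bar R := fun A => ext 0 A w0.

Lemma mu0_0 : mu0 set0 = 0.
Proof. by rewrite /mu0 (@extE 0)// pth0E indic0. Qed.

Lemma mu0_ge0 A : 0 <= mu0 A.
Proof.
have [cA|ncA] := pselect (cyl A); first exact: ext_ge0.
have [cvA|ncvA] := pselect (cvgn (fun m => pth m 0 w0 A)); last first.
  by rewrite /mu0 /ext (dvgP ncvA).
by apply: lime_ge => //; exact: nearW.
Qed.

Lemma mu0U A B : cyl A -> cyl B -> A `&` B = set0 ->
  mu0 (A `|` B) = mu0 A + mu0 B.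
Proof.
move=> cA cB AB; have [mAB [p dAB]] := cylU cA cB.
case: cA cB => mA [m dA] [mB [n dB]].
rewrite /mu0 !(@extE (m + n + p)).
- by rewrite measureU.
- by apply: dep_le dB; rewrite add0n -addnA addnCA leq_addr.
- by apply: dep_le dA; rewrite add0n -addnA leq_addr.
- by apply: dep_le dAB; rewrite add0n leq_addl.
Qed.

Lemma mu0_fin A : cyl A -> mu0 A \is a fin_num.
Proof.
move=> cA; rewrite ge0_fin_numE ?mu0_ge0//.
by apply: le_lt_trans (ext_le1 0 w0 cA) _; exact: ltry.
Qed.

Lemma mu0_sigma_additive : semi_sigma_additive mu0.
Proof.
move=> F mF tF mUF.
pose B := fix B n := if n is n'.+1 then B n' `\` F n' else \bigcup_i F i.
have cB n : cyl (B n) by elim: n => [//|n IH] /=; apply: cylD => //; exact: mF.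
have BP n x : B n x <-> (\bigcup_i F i) x /\ forall i, (i < n)%N -> ~ F i x.
  elim: n => [|n IH] /=; first by split => [|[]].
  split=> [[/IH [Ux nF] nFn]|[Ux nF]].
    split => // i; rewrite ltnS leq_eqVlt => /predU1P[->//|]; exact: nF.
  by split; [apply/IH; split => // i ni; apply: nF; exact: leqW|exact: nF].
have FB n : F n `<=` B n.
  move=> x Fx; apply/BP; split; first by exists n.
  move=> i ni Fi; have E : i = n by apply: tF => //; exists x.
  by rewrite E ltnn in ni.
have B0 : \bigcap_n B n = set0.
  rewrite -subset0 => x Bx; have [k _ Fk] : (\bigcup_i F i) x := Bx 0%N I.
  by have /BP[_ /(_ k (ltnSn k))] := Bx k.+1 I.
have mB : mu0 (B n) @[n --> \oo] --> 0.
  by apply: ext_empty => // n x [].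
have sumE n : \sum_(0 <= i < n) mu0 (F i) = mu0 (\bigcup_i F i) - mu0 (B n).
  suff -> : mu0 (\bigcup_i F i) = \sum_(0 <= i < n) mu0 (F i) + mu0 (B n).
    by rewrite addeK// mu0_fin.
  elim: n => [|n IH]; first by rewrite big_geq// add0e.
  rewrite big_nat_recr//= IH -addeA; congr (_ + _).
  rewrite -mu0U; [|exact: mF|exact: cB n.+1|by rewrite setDE setICA setICr setI0].
  by rewrite setDUK.
rewrite (_ : (fun n => _) = (fun n => mu0 (\bigcup_i F i) - mu0 (B n))); last first.
  by apply/funext.
rewrite -[X in _ --> X]sube0; apply: cvgeB => //.
  by rewrite fin_num_adde_defl// mu0_fin.
exact: cvg_cst.
Qed.

HB.instance Definition _ := isMeasure.Build _ cylT R mu0 mu0_0 mu0_ge0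
  mu0_sigma_additive.

Let I := g_sigma_algebraType (@measurable _ cylT).

Lemma measurable_from_cyl : measurable_fun setT (id : I -> traj S).
Proof.
apply: measurable_trajP => i _ B mB; rewrite setTI.
apply: sub_sigma_algebra; split.
  by rewrite -[X in measurable X]setTI; exact: measurable_coord.
by exists i.+1 => w w' ww' /=; rewrite ww'.
Qed.

Lemma measurable_salg (A : set (traj S)) : measurable A ->
  measurable (A : set I).
Proof. by move=> mA; rewrite -[X in measurable X]setTI; exact: measurable_from_cyl. Qed.

Definition trajP (A : set (traj S)) : \bar R := measure_extension mu0 (A : set I).

Lemma trajP0 : trajP set0 = 0. Proof. exact: measure0. Qed.
Lemma trajP_ge0 A : 0 <= trajP A. Proof. exact: measure_ge0. Qed.
Lemma trajP_sigma_additive : semi_sigma_additive trajP.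
Proof.
move=> F mF tF mUF; apply: measure_semi_sigma_additive => //.
  by move=> i; exact: measurable_salg.
exact: measurable_salg.
Qed.

HB.instance Definition _ := isMeasure.Build _ _ _ trajP trajP0 trajP_ge0
  trajP_sigma_additive.

Lemma trajPE A : cyl A -> trajP A = ext 0 A w0.
Proof. by move=> cA; rewrite /trajP /measure_extension measurable_mu_extE. Qed.

Lemma cylTT : cyl setT. Proof. by split => //; exists 0%N. Qed.

Lemma trajPT : trajP setT = 1.
Proof.
rewrite trajPE; last exact: cylTT.
by rewrite (@extE 0)// pth0E indicT.
Qed.

HB.instance Definition _ := Measure_isProbability.Build _ _ _ trajP trajPT.

Definition trunc t (w : traj S) : traj S := fun i => if (i < t)%N then w i else point.

Lemma measurable_trunc t : measurable_fun setT (trunc t).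
Proof.
apply: measurable_trajP => i; rewrite /trunc; case: (i < t)%N => //.
exact: measurable_coord.
Qed.

Lemma trunc_dep t (A : set (traj S)) : dep t (trunc t @^-1` A).
Proof.
move=> w w' ww' /=; rewrite (_ : trunc t w = trunc t w')//.
by apply/funext => i; rewrite /trunc; case: ifP => // /ww'.
Qed.

Lemma integral_trajP t (f : traj S -> \bar R) :
  (forall z, 0 <= f z) -> measurable_fun setT f ->
  (forall w, f (trunc t w) = f w) ->
  \int[trajP]_w f w = \int[pth t 0 w0]_w f w.
Proof.
move=> f0 mf ft.
pose Q (m : {measure set (traj S) -> \bar R}) : {measure set (traj S) -> \bar R} :=
  @measure_function_pushforward__canonical__measure_function_Measure
    _ _ _ _ R m (trunc t) (@measurable_trunc t).
have H (m : {measure set (traj S) -> \bar R}) :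
   \int[m]_w f w = \int[Q m]_w f w.
  rewrite (ge0_integral_pushforward (@measurable_trunc t))//.
  by rewrite preimage_setT; apply: eq_integral => w _ /=; rewrite ft.
rewrite H [RHS]H; apply: eq_measure_integral => A mA _.
rewrite /Q /= /pushforward trajPE; last first.
  split; last by exists t; exact: trunc_dep.
  by rewrite -[X in measurable X]setTI; exact: (@measurable_trunc t).
by rewrite (@extE t)//; exact: trunc_dep.
Qed.

Lemma trajP_chain t H B : history t H -> measurable B ->
  trajP (H `&` [set w | B (w t)]) = \int[trajP]_(w in H) Pi (st t w) B.
Proof.
move=> hH mB; have dH := history_dep hH; have mH := history_measurable hH.
have mBt : measurable [set w : traj S | B (w t)].
  by rewrite -[X in measurable X]setTI; exact: measurable_coord.
have dHB : dep t.+1 (H `&` [set w | B (w t)]).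
  move=> w w' ww' [Hw Bw]; split; last by rewrite /= -ww'.
  by apply: dH Hw => i it; apply: ww'; exact: leqW.
rewrite trajPE; last by split; [exact: measurableI|exists t.+1].
rewrite (@extE t.+1)//.
transitivity (\int[pth t.+1 0 w0]_w (\1_(H `&` [set w | B (w t)]) w)%:E).
  by rewrite integral_indic ?setIT//; exact: measurableI.
rewrite integral_pth_last; last 2 first.
- by move=> z; rewrite lee_fin.
- by apply/measurable_EFinP; apply: measurable_indic; exact: measurableI.
rewrite [RHS]integral_mkcond add0n.
have tr w i : (i < t)%N -> trunc t w i = w i by rewrite /trunc => ->.
rewrite (@integral_trajP t); last 3 first.
- by move=> w; rewrite /patch; case: ifP.
- have /(measurable_restrictT _ mH) : measurable_fun H (fun v => Pi (st t v) B).
    apply: measurable_funTS.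
    exact: (measurableT_comp (measurable_kernel Pi B mB) (mst t)).
  by [].
- move=> w; rewrite !patchE (dst (tr w)).
  suff -> : (trunc t w \in H) = (w \in H) by [].
  by apply/idP/idP => /set_mem Hw; apply/mem_set; apply: dH Hw => i it; rewrite tr.
apply: eq_integral => w _; rewrite patchE.
have E y : (upd w t y \in H) = (w \in H).
  by apply/idP/idP => /set_mem Hw; apply/mem_set; apply: dH Hw => i it;
    rewrite /upd ltn_eqF.
under eq_integral => y _.
  rewrite indicE in_setI E.
  rewrite (_ : (upd w t y \in [set w1 | B (w1 t)]) = (y \in B)); last first.
    by apply/idP/idP => /set_mem; rewrite /upd /= ?eqxx => h; apply/mem_set;
      rewrite //= eqxx.
  over.
case: (w \in H) => /=; last by rewrite integral0.
transitivity (\int[stepk t w]_y (\1_B y)%:E).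
  by apply: eq_integral => y _; rewrite indicE.
by rewrite integral_indic ?setIT.
Qed.

End ionescu_tulcea.

Theorem conditional_law_exists d (S : measurableType d) d' (Y : measurableType d')
    (R : realType) (Pi : R.-pker Y ~> S) (st : nat -> traj S -> Y)
    (mst : forall t, measurable_fun setT (st t))
    (dst : forall t (w w' : traj S),
      (forall i, (i < t)%N -> w i = w' i) -> st t w = st t w') :
  exists P : probability (traj S) R, conditional_law Pi st P.
Proof.
exists (trajP Pi mst (fun=> point)) => t H B hH mB.
exact: trajP_chain.
Qed.

#[short(type="pfinType")]
HB.structure Definition PointedFinite := {T of Finite T & Pointed T}.

(* A nonempty finite set of actions, with the discrete sigma-algebra. *)
Definition action (X : pfinType) : Type := X.
HB.instance Definition _ (X : pfinType) := PointedFinite.on (action X).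
HB.instance Definition _ (X : pfinType) :=
  @isMeasurable.Build default_measure_display (action X) discrete_measurable
    discrete_measurable0 discrete_measurableC discrete_measurableU.

(* There are n.+1 pure worldviews, indexed by 'I_n.+1. *)
Definition simplex (R : realType) (n : nat) : set 'rV[R]_n.+1 :=
  [set a | (forall j, 0 <= a ord0 j) /\ \sum_j a ord0 j = 1].

Definition worldview (R : realType) (n : nat) : Type := set_type (@simplex R n).

HB.instance Definition _ (R : realType) n :=
  Topological.copy (worldview R n) (set_type (@simplex R n)).

Definition weight (R : realType) n (a : worldview R n) (j : 'I_n.+1) : R :=
  set_val a ord0 j.
Coercion weight : worldview >-> Funclass.

Lemma pure_subproof (R : realType) n (j : 'I_n.+1) :
  delta_mx ord0 j \in @simplex R n.
Proof.
apply/mem_set; split=> [k|]; first by rewrite mxE ler0n.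
rewrite (bigD1 j)//= mxE !eqxx big1 ?addr0// => k kj.
by rewrite mxE (negbTE kj) andbF.
Qed.

Definition pure (R : realType) n (j : 'I_n.+1) : worldview R n :=
  exist _ (delta_mx ord0 j) (pure_subproof R j).

Definition pures (R : realType) n : set (worldview R n) := range (@pure R n).
Arguments pures R n : clear implicits.

Lemma barycenter_subproof (R : realType) n :
  const_mx (n.+1%:R^-1) \in @simplex R n.
Proof.
apply/mem_set; split=> [k|]; first by rewrite mxE invr_ge0.
under eq_bigr do rewrite mxE.
by rewrite sumr_const card_ord -[RHS](@mulVf _ n.+1%:R)// mulr_natr.
Qed.

Definition barycenter (R : realType) n : worldview R n :=
  exist _ (const_mx (n.+1%:R^-1)) (barycenter_subproof R n).

HB.instance Definition _ (R : realType) n :=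
  isPointed.Build (worldview R n) (barycenter R n).
HB.instance Definition _ (R : realType) n :=
  @isMeasurable.Build (sigma_display (@open (worldview R n))) (worldview R n)
    <<s @open (worldview R n) >> (@sigma_algebra0 _ setT _)
    (@sigma_algebraC (worldview R n) _) (@sigma_algebra_bigcup _ setT _).

Section model.
Context (R : realType) (n : nat).
Implicit Types (a b : worldview R n) (A B : set (worldview R n)).

Definition dist1 a b : R := \sum_j `|a j - b j|.
Definition dist1_to a B : R := inf [set dist1 a b | b in B].
Definition dist1_sets A B : R := inf [set dist1 a b | a in A & b in B].

Context (X : pfinType) (u : 'I_n.+1 -> X -> R) (delta lambda : R).

Definition utility a (x : X) : R := \sum_j a j * u j x.

Definition zstar a : set X := [set x | forall y, utility a y <= utility a x].

(* the maximum over the nonempty finite set X *)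
Definition hmax a : R := sup (range (utility a)).

Definition qval abar b (x : X) : R :=
  (1 - lambda) * utility b x + lambda * utility abar x.

Definition Kset abar : set (worldview R n) :=
  [set b | exists2 x, zstar b x & qval abar b x = hmax abar].

(* The outcome drawn in period t is (x_t, alpha_(t+1)). *)
Definition strategy := R.-pker (worldview R n) ~> (action X * worldview R n)%type.

Definition state (b : worldview R n) (t : nat)
    (w : traj (action X * worldview R n)%type) : worldview R n :=
  if t is t'.+1 then (w t').2 else b.

Definition act (t : nat) (w : traj (action X * worldview R n)%type) : X := (w t).1.

Lemma measurable_state b t : measurable_fun setT (state b t).
Proof.
case: t => [|t]; first exact: measurable_cst.
exact: (measurableT_comp measurable_snd (@measurable_coord _ _ t)).
Qed.

Lemma state_history b t (w w' : traj (action X * worldview R n)%type) :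
  (forall i, (i < t)%N -> w i = w' i) -> state b t w = state b t w'.
Proof. by case: t => //= t ->. Qed.

(* The law of the path of outcomes from the initial state alpha_0 = b; the
   property lawP determines it. *)
Definition law (Pi : strategy) b :
    probability (traj (action X * worldview R n)%type) R :=
  projT1 (cid (conditional_law_exists Pi (measurable_state b) (@state_history b))).

Lemma lawP Pi b : conditional_law Pi (state b) (law Pi b).
Proof. exact: projT2 (cid _). Qed.

Definition action_marginal (Pi : strategy) a : set X -> \bar R :=
  pushforward (Pi a) (fst : action X * worldview R n -> action X).

Definition state_marginal (Pi : strategy) a : set (worldview R n) -> \bar R :=
  pushforward (Pi a) snd.

HB.instance Definition _ Pi a := Measure.copy (state_marginal Pi a)
  (@measure_function_pushforward__canonical__measure_function_Measure
    _ _ _ _ R (Pi a) snd measurable_snd).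

Definition path_payoff a b (w : traj (action X * worldview R n)%type) : R :=
  limn (series (fun k => delta ^+ k *
    ((1 - lambda) * utility (state b k w) (act k w)
     + lambda * utility a (act k w)))).

(* C_Pi(b; a) *)
Definition continuation (Pi : strategy) b a : \bar R :=
  'E_(law Pi b)[path_payoff a b].

Definition chosen_value (Pi : strategy) a : \bar R :=
  \int[state_marginal Pi a]_b continuation Pi b a.

Definition stationary_MPE (Pi : strategy) : Prop :=
  forall a, action_marginal Pi a (zstar a) = 1%E /\
    forall g, (continuation Pi g a <= chosen_value Pi a)%E.

End model.

Inductive actionB := actB_c | actB_a | actB_b.

Definition actionB_code (x : actionB) : option bool :=
  match x with actB_c => None | actB_a => Some true | actB_b => Some false end.

Definition actionB_decode (o : option bool) : actionB :=
  match o with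
  | None => actB_c | Some true => actB_a | Some false => actB_b
  end.

Lemma actionB_codeK : cancel actionB_code actionB_decode.
Proof. by case. Qed.

HB.instance Definition _ := Finite.copy actionB (can_type actionB_codeK).
HB.instance Definition _ := isPointed.Build actionB actB_c.

(* ord0 is worldview 1 *)
Definition payoffB (R : realType) (j : 'I_2) (x : actionB) : R :=
  if j == ord0
  then match x with actB_c => 0 | actB_a => 1 | actB_b => -3 end
  else match x with actB_c => 0 | actB_a => -3 | actB_b => 1 end.

HB.instance Definition _ n := Pointed.on (option 'I_n.+1).

(* None is the action c and Some i is the action a_i. *)
Definition payoffC (R : realType) n (M : R) (j : 'I_n.+1)
    (x : option 'I_n.+1) : R :=
  if x is Some i then (if j == i then 1 else - M) else 0.

(* Main.v *)
(* Let r_k = q_a(alpha_k, x_k). Since x_k is optimal at alpha_k,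
   r_k = (1 - lambda) h(alpha_k) + lambda U(a, x_k), so E_b[r_k] is obtained by
   iterating the transition operator, which gives
   C(b; a) = sum_k delta^k E_b[r_k] and S(a) = sum_k delta^k E_a[r_(k+1)].
   If q_a <= V on optimal pairs, then S(a) <= V / (1 - delta), with equality only
   if r_t = V almost surely for every t >= 1. The reverse inequality comes from
   the equilibrium condition S(a) >= C(g; a): with g = a it gives
   S(a) >= h(a) + delta S(a), so V = h(a) is always reached, and with g an
   absorbing pure worldview it gives the payoff of staying there.
   With a safe action c (payoff 0) and specialists a_i, the payoff q_a(b, a_i) is
   maximal exactly at the pure worldview i, where it equals
   1 - lambda (1 + M) (1 - a^i); at the barycenter the sign of this number is
   that of lambda_c - lambda. Equilibria are obtained from deterministic
   strategies that move once to the best of the pure worldviews and the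
   barycenter; the two ways of breaking ties give the two equilibria at
   lambda = lambda_c. Part (B) is the case n = 2, M = 3 of part (C). *)

Require Import Defs.
From HB Require Import structures.
From mathcomp Require Import all_boot all_order all_algebra.
From mathcomp Require Import all_classical all_reals all_analysis.
From mathcomp Require Import measurable_realfun ring lra.
Import Order.TTheory GRing.Theory Num.Theory.
Import numFieldNormedType.Exports.
Local Open Scope classical_set_scope.
Local Open Scope ring_scope.

Set Implicit Arguments.
Unset Strict Implicit.
Unset Printing Implicit Defensive.

(** * Integrals of real functions against a probability measure *)

Section probability_integral.
Context d (T : measurableType d) (R : realType).
Variable mu : {measure set T -> \bar R}.
Hypothesis mu1 : mu setT = 1%E.
Implicit Types (f g : T -> R) (B V : R).

Lemma bounded_integrable f B : measurable_fun setT f ->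
  (forall x, `|f x| <= B) -> mu.-integrable setT (EFin \o f).
Proof.
move=> mf fB; apply: measurable_bounded_integrable => //.
  by rewrite mu1 ltry.
exists B; split; first exact: num_real.
by move=> M BM x _; apply: le_trans (fB x) (ltW BM).
Qed.

Lemma EFin_Rintegral f : mu.-integrable setT (EFin \o f) ->
  (\int[mu]_x (f x)%:E)%E = (Rintegral mu setT f)%:E.
Proof. by move=> fi; rewrite /Rintegral fineK// integrable_fin_num. Qed.

Lemma integrable_cst1 V : mu.-integrable setT (EFin \o (fun=> V)).
Proof. by apply: (@bounded_integrable _ `|V|). Qed.

Lemma Rintegral_cst1 V : Rintegral mu setT (fun=> V) = V.
Proof. by rewrite Rintegral_cst// mu1 mulr1. Qed.

Lemma Rintegral_bound f B : measurable_fun setT f ->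
  (forall x, `|f x| <= B) -> `|Rintegral mu setT f| <= B.
Proof.
move=> mf fB; rewrite (le_trans (le_normr_Rintegral _ _))//.
  exact: bounded_integrable fB.
rewrite -[leRHS]Rintegral_cst1; apply: le_Rintegral => //.
  by apply: integrable_norm => //; exact: bounded_integrable fB.
exact: integrable_cst1.
Qed.

Lemma ae_eq_Rintegral f g : measurable_fun setT f -> measurable_fun setT g ->
  {ae mu, forall x, f x = g x} -> Rintegral mu setT f = Rintegral mu setT g.
Proof.
move=> mf mg fg; congr fine; apply: ae_eq_integral => //.
- exact/measurable_EFinP.
- exact/measurable_EFinP.
- by apply: filterS fg => x fgx _ /=; rewrite fgx.
Qed.

(** The truncated gap [g = max 0 (V - f)] is nonnegative everywhere and equals [V - f] almost
    everywhere. Its integral is [V] minus that of [f]; if this is zero, [g] vanishes almost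
    everywhere. *)
Lemma ae_eq_Rintegral_max f V : mu.-integrable setT (EFin \o f) ->
  {ae mu, forall x, f x <= V} ->
  Rintegral mu setT f <= V /\
  (Rintegral mu setT f = V -> {ae mu, forall x, f x = V}).
Proof.
move=> fi fV.
have /measurable_EFinP mf := measurable_int _ fi.
pose g x := Num.max 0 (V - f x).
have mVf : measurable_fun setT (fun x => V - f x).
  exact: measurable_funB.
have mg : measurable_fun setT g by apply: measurable_maxr.
have gE : Rintegral mu setT g = V - Rintegral mu setT f.
  rewrite (@ae_eq_Rintegral g (fun x => V - f x))//.
    rewrite RintegralB ?Rintegral_cst1//; exact: integrable_cst1.
  by apply: filterS fV => x fx; rewrite /g max_r// subr_ge0.
have g0 x : 0 <= g x by rewrite le_max lexx.
split; first by rewrite -subr_ge0 -gE; apply: Rintegral_ge0 => x _; exact: g0.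
move=> fE.
have gi : mu.-integrable setT (EFin \o g).
  have Vfi : mu.-integrable setT (EFin \o (fun x => V - f x)).
    exact: (integrableB measurableT (integrable_cst1 V) fi).
  apply: (le_integrable measurableT _ _ Vfi).
    exact/measurable_EFinP.
  move=> x _ /=; rewrite lee_fin ger0_norm ?g0//.
  by rewrite /g ge_max normr_ge0 ler_norm.
have /ae_eq_integral_abs : measurable_fun setT (EFin \o g).
  exact/measurable_EFinP.
move=> /(_ mu measurableT)[+ _] => h.
have : ae_eq mu setT (EFin \o g) (cst 0%E).
  apply: h; under eq_integral => x _ do rewrite /= ger0_norm ?g0//.
  by rewrite EFin_Rintegral// gE fE subrr.
move=> {}h; apply: filterS2 fV h => x fx /(_ I)[].
by rewrite /g max_r ?subr_ge0// => /eqP; rewrite subr_eq0 => /eqP.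
Qed.

End probability_integral.

Lemma ae_probability1 d (T : measurableType d) (R : realType)
    (P : probability T R) (A : set T) :
  measurable A -> {ae P, forall x, A x} -> P A = 1%E.
Proof.
move=> mA /negligibleP -/(_ (measurableC mA)) A0.
by rewrite -(setCK A) probability_setC ?A0 ?sube0//; exact: measurableC.
Qed.

(** * Discounted sums of bounded sequences *)

Section discounted_sum.
Context (R : realType) (delta : R).
Hypotheses (delta_gt0 : 0 < delta) (delta_lt1 : delta < 1).
Implicit Types (u v : nat -> R).

Definition discounted u : R := limn (series (fun k => delta ^+ k * u k)).

Lemma cvg_geometric1 : series (fun k => delta ^+ k) @ \oo --> (1 - delta)^-1.
Proof.
rewrite (_ : (fun k => _) = geometric 1 delta).
  have := @cvg_geometric_series R 1 delta.
  by rewrite ger0_norm ?(ltW delta_gt0)// div1r => /(_ delta_lt1).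
by apply/funext => k; rewrite /geometric/= mul1r.
Qed.

Lemma series_geometric_le n : series (fun k => delta ^+ k) n <= (1 - delta)^-1.
Proof.
rewrite -(cvg_lim _ cvg_geometric1)//; apply: nondecreasing_cvgn_le.
  apply/nondecreasing_seqP => k; rewrite /series/= big_nat_recr//= lerDl.
  by rewrite exprn_ge0 ?(ltW delta_gt0).
by apply/cvg_ex; eexists; exact: cvg_geometric1.
Qed.

Lemma is_cvg_discounted u B : (forall k, `|u k| <= B) ->
  cvgn (series (fun k => delta ^+ k * u k)).
Proof.
move=> uB; apply: normed_cvg.
apply: (@series_le_cvg _ _ (fun k => delta ^+ k * B)).
- by move=> n; rewrite normr_ge0.
- by move=> n; rewrite mulr_ge0 ?exprn_ge0 ?(ltW delta_gt0)// (le_trans _ (uB 0%N)).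
- by move=> n /=; rewrite normrM ger0_norm ?exprn_ge0 ?(ltW delta_gt0)// ler_wpM2l//
    exprn_ge0// ltW.
- rewrite (_ : series _ = fun n => B * series (fun k => delta ^+ k) n).
    apply: is_cvgM; first exact: is_cvg_cst.
    by apply/cvg_ex; eexists; exact: cvg_geometric1.
  by apply/funext => n; rewrite /series/= mulr_sumr; apply: eq_bigr => k _; rewrite mulrC.
Qed.

Lemma discounted_cst V : discounted (fun=> V) = V / (1 - delta).
Proof.
apply/cvg_lim => //.
rewrite (_ : series _ = fun n => V * series (fun k => delta ^+ k) n).
  by apply: cvgM; [exact: cvg_cst|exact: cvg_geometric1].
by apply/funext => n; rewrite /series/= mulr_sumr; apply: eq_bigr => k _; rewrite mulrC.
Qed.

Lemma eq_discounted u v : u =1 v -> discounted u = discounted v.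
Proof. by move=> /funext ->. Qed.

Lemma discounted_recl u B : (forall k, `|u k| <= B) ->
  discounted u = u 0%N + delta * discounted (fun k => u k.+1).
Proof.
move=> uB; apply/cvg_lim => //.
have us := @is_cvg_discounted (fun k => u k.+1) B (fun k => uB k.+1).
rewrite -(cvg_shiftS _)/=.
rewrite (_ : (fun n => _) = fun n => u 0%N + delta *
    series (fun k => delta ^+ k * u k.+1) n).
  by apply: cvgD; [exact: cvg_cst|apply: cvgM => //; exact: cvg_cst].
apply/funext => n; rewrite /series/= big_nat_recl//= expr0 mul1r; congr (_ + _).
by rewrite mulr_sumr; apply: eq_bigr => k _; rewrite exprS mulrA.
Qed.

(** If the sum reaches [V / (1 - delta)], its first term must be [V] and its tail must reach the
    same bound again; induction then fixes every term. *)
Lemma le_discounted u V B : (forall k, `|u k| <= B) -> (forall k, u k <= V) ->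
  discounted u <= V / (1 - delta) /\
  (V / (1 - delta) <= discounted u -> forall k, u k = V).
Proof.
move=> uB uV.
have step v : (forall k, `|v k| <= B) -> (forall k, v k <= V) ->
    discounted v <= V / (1 - delta).
  move=> vB vV; rewrite -discounted_cst; apply: ler_lim.
  - exact: is_cvg_discounted vB.
  - exact: (@is_cvg_discounted (fun=> V) `|V|).
  - apply: nearW => n; apply: ler_sum => k _.
    by rewrite ler_wpM2l ?exprn_ge0 ?(ltW delta_gt0).
split; first exact: step.
have main v : (forall k, `|v k| <= B) -> (forall k, v k <= V) ->
    V / (1 - delta) <= discounted v ->
    v 0%N = V /\ V / (1 - delta) <= discounted (fun k => v k.+1).
  move=> vB vV; rewrite (discounted_recl vB) => Vd.
  have d0 : 1 - delta != 0 by rewrite subr_eq0 eq_sym lt_eqF.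
  have VE : V / (1 - delta) = V + delta * (V / (1 - delta)) by field.
  have := step (fun k => v k.+1) (fun k => vB k.+1) (fun k => vV k.+1).
  have := vV 0%N; set x := discounted _ in Vd *; set y := V / _ in VE Vd * => v0 xy.
  have dxy : delta * x <= delta * y by rewrite ler_wpM2l// ltW.
  have v0E : v 0%N = V by apply/eqP; rewrite eq_le v0; lra.
  split => //; rewrite -(ler_pM2l delta_gt0); lra.
move=> Vu k.
suff /main[] : V / (1 - delta) <= discounted (fun i => u (k + i)%N).
- by move=> i; exact: uB.
- by move=> i; exact: uV.
- by rewrite addn0.
elim: k => [|k IH]; first by under eq_discounted do rewrite add0n.
have [||//|_] := main (fun i => u (k + i)%N); [by []|by []|].
by under eq_discounted do rewrite addnS -addSn.
Qed.

(** Dominated convergence: all partial sums are bounded by the constant [B / (1 - delta)], and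
    finite sums commute with the integral. *)
Lemma Rintegral_discounted d (T : measurableType d)
    (mu : {measure set T -> \bar R}) (f : nat -> T -> R) B :
  mu setT = 1%E -> (forall k, measurable_fun setT (f k)) ->
  (forall k x, `|f k x| <= B) ->
  (\int[mu]_x (discounted (f ^~ x))%:E)%E =
  (discounted (fun k => Rintegral mu setT (f k)))%:E.
Proof.
move=> mu1 mf fB.
pose g n x := series (fun k => delta ^+ k * f k x) n.
have mg n : measurable_fun setT (g n).
  apply: measurable_sum => k.
  by apply: measurable_funM.
have g_cvg x : g ^~ x @ \oo --> discounted (f ^~ x).
  exact: (@is_cvg_discounted (f ^~ x) B).
have B0 : 0 <= B by apply: le_trans (fB 0%N point).
have gB n x : `|g n x| <= B * (1 - delta)^-1.
  apply: le_trans (ler_norm_sum _ _ _) _.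
  apply: (@le_trans _ _ (B * series (fun k => delta ^+ k) n)).
    rewrite /series/= mulr_sumr; apply: ler_sum => k _.
    by rewrite normrM ger0_norm ?exprn_ge0 ?(ltW delta_gt0)// mulrC ler_wpM2r//
      exprn_ge0// ltW.
  by rewrite ler_wpM2l// series_geometric_le.
have mfd : measurable_fun setT (fun x => discounted (f ^~ x)).
  exact: (@measurable_fun_cvg _ _ _ _ g).
have [] := @dominated_convergence _ _ _ mu setT measurableT
  (fun n => EFin \o g n) (EFin \o (fun x => discounted (f ^~ x)))
  (cst (B * (1 - delta)^-1)%:E).
- by move=> n; exact/measurable_EFinP.
- exact/measurable_EFinP.
- by apply: aeW => x _; apply: cvg_EFin; [exact: nearW|exact: g_cvg].
- exact: (integrable_cst1 mu1).
- by apply: aeW => x n _ /=; rewrite lee_fin.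
move=> fi _ cv; rewrite EFin_Rintegral//; congr (_%:E).
apply/esym/cvg_lim => //.
have gi n : mu.-integrable setT (EFin \o g n).
  exact: (bounded_integrable mu1 (mg n) (gB n)).
rewrite (_ : series _ = fun n => fine (\int[mu]_x (EFin \o g n) x)%E).
  by apply: fine_cvg; rewrite fineK ?integrable_fin_num.
apply/funext => n.
elim: n => [|n IH].
  rewrite /series/= big_geq// -[LHS](Rintegral_cst1 mu1 0); congr fine.
  by apply: eq_integral => x _; rewrite /= /g /series/= big_geq.
rewrite [LHS]/series/= big_nat_recr//= -[X in X + _]/(series _ n) IH.
have fi' : mu.-integrable setT (EFin \o f n) := bounded_integrable mu1 (mf n) (fB n).
rewrite -RintegralZl// -[LHS]RintegralD//.
  apply: eq_Rintegral => x _; by rewrite /g/= /series/= big_nat_recr.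
exact: (integrableZl measurableT _ fi').
Qed.

End discounted_sum.

(** * Integration against probability kernels *)

Section kernel_integral.
Context d d' (S : measurableType d) (Y : measurableType d') (R : realType).
Variable K : R.-pker Y ~> S.

(** Shifting by [B] makes the integrand nonnegative; the shift is removed afterwards because [K y]
    has mass one. *)
Lemma measurable_Rintegral_kernel (f : S -> R) (B : R) : measurable_fun setT f ->
  (forall s, `|f s| <= B) -> measurable_fun setT (fun y => Rintegral (K y) setT f).
Proof.
move=> mf fB.
have fi y : (K y).-integrable setT (EFin \o f).
  exact: (bounded_integrable (prob_kernel y) mf fB).
rewrite (_ : (fun y => _) = fun y => fine (\int[K y]_s (f s + B)%:E)%E - B).
  apply: measurable_funB => //; apply: (measurableT_comp (@fine_measurable _ setT measurableT)).
  apply: measurable_fun_integral_kernel.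
  - exact: measurable_kernel.
  - by move=> z; rewrite lee_fin -lerBlDr sub0r; have := fB z; rewrite ler_norml => /andP[].
  - by apply/measurable_EFinP; apply: measurable_funD.
apply/funext => y; rewrite -[X in _ = X - _]/(Rintegral _ _ _) RintegralD//.
  by rewrite (Rintegral_cst1 (prob_kernel y)) addrK.
exact: (integrable_cst1 (prob_kernel y)).
Qed.

Context d2 (T : measurableType d2) (P : probability T R).
Context (X : T -> S) (st : T -> Y).
Hypotheses (mX : measurable_fun setT X) (mst : measurable_fun setT st).
Hypothesis XP : forall A, measurable A -> P (X @^-1` A) = (\int[P]_w K (st w) A)%E.

(** With [P] seen as a kernel from a one-point space, the law of [X] is a composite of two kernels,
    and integrals against it are iterated integrals. *)
Definition const_kernel (_ : unit) : {measure set T -> \bar R} := P.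

Lemma measurable_const_kernel U : measurable U ->
  measurable_fun [set: unit] (const_kernel ^~ U).
Proof. by move=> mU; exact: measurable_cst. Qed.

HB.instance Definition _ :=
  isKernel.Build _ _ _ _ R const_kernel measurable_const_kernel.
HB.instance Definition _ :=
  Kernel_isProbability.Build _ _ _ _ R const_kernel (fun=> probability_setT P).

Definition step_kernel (z : unit * T) : {measure set S -> \bar R} := K (st z.2).

Lemma measurable_step_kernel U : measurable U ->
  measurable_fun [set: unit * T] (step_kernel ^~ U).
Proof.
move=> mU; apply: (measurableT_comp (measurable_kernel K U mU)).
exact: (measurableT_comp mst measurable_snd).
Qed.

HB.instance Definition _ :=
  isKernel.Build _ _ _ _ R step_kernel measurable_step_kernel.
HB.instance Definition _ :=
  Kernel_isProbability.Build _ _ _ _ R step_kernel (fun z => prob_kernel (st z.2)).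

(** By [XP], the image of [P] under [X] and the composite of [const_kernel] with [step_kernel] are
    the same measure. *)
Lemma ge0_integral_conditional (f : S -> \bar R) : (forall s, 0 <= f s)%E ->
  measurable_fun setT f ->
  (\int[P]_w f (X w) = \int[P]_w \int[K (st w)]_s f s)%E.
Proof.
move=> f0 mf.
rewrite -[RHS](@integral_kcomp _ _ _ _ _ _ _ const_kernel step_kernel tt)//.
pose Q : {measure set S -> \bar R} :=
  @measure_function_pushforward__canonical__measure_function_Measure
    _ _ _ _ R P X mX.
transitivity (\int[Q]_s f s)%E.
  by rewrite [RHS](ge0_integral_pushforward mX)// preimage_setT.
by apply: eq_measure_integral => A mA _; exact: XP.
Qed.

Lemma Rintegral_conditional (f : S -> R) (B : R) : measurable_fun setT f ->
  (forall s, `|f s| <= B) ->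
  Rintegral P setT (f \o X) =
  Rintegral P setT (fun w => Rintegral (K (st w)) setT f).
Proof.
move=> mf fB.
pose g s := f s + B.
have mg : measurable_fun setT g by exact: measurable_funD.
have g0 s : 0 <= g s.
  by rewrite /g -lerBlDr sub0r; have := fB s; rewrite ler_norml => /andP[].
have P1 := probability_setT P.
have fi y : (K y).-integrable setT (EFin \o f).
  exact: (bounded_integrable (prob_kernel y) mf fB).
have := @ge0_integral_conditional (EFin \o g) g0.
move=> /(_ (iffRL (measurable_EFinP _ _) mg)).
have gK y : (\int[K y]_s (g s)%:E)%E = (Rintegral (K y) setT f + B)%:E.
  rewrite EFin_Rintegral.
    rewrite RintegralD ?(Rintegral_cst1 (prob_kernel y))//.
    exact: (integrable_cst1 (prob_kernel y)).
  exact: (integrableD measurableT (fi y) (integrable_cst1 (prob_kernel y) B)).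
under [X in _ = X -> _]eq_integral do rewrite /= gK.
move=> /(congr1 fine); rewrite -[LHS]/(Rintegral _ _ (fun w => f (X w) + B)).
rewrite -[RHS]/(Rintegral _ _ (fun w => Rintegral (K (st w)) setT f + B)).
rewrite !RintegralD ?(Rintegral_cst1 P1)//.
- by move/addIr.
- apply: (@bounded_integrable _ _ _ _ P1 _ B).
    exact: (measurableT_comp (measurable_Rintegral_kernel mf fB) mst).
  by move=> w; apply: Rintegral_bound => //; exact: prob_kernel.
- exact: (integrable_cst1 P1).
- apply: (@bounded_integrable _ _ _ _ P1 _ B) => //.
  exact: (measurableT_comp mf mX).
- exact: (integrable_cst1 P1).
Qed.

End kernel_integral.

(** * Worldviews, payoffs and the law of the process *)

Section model_facts.
Context (R : realType) (n : nat) (X : pfinType) (u : 'I_n.+1 -> X -> R).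
Implicit Types (a b : worldview R n) (x y : X) (lambda : R).

Lemma weight_ge0 a j : 0 <= a j.
Proof. by have /set_mem[/(_ j)] := valP a. Qed.

Lemma sum_weight a : \sum_j a j = 1.
Proof. by have /set_mem[_] := valP a. Qed.

Lemma weight_le1 a j : a j <= 1.
Proof.
rewrite -(sum_weight a) (bigD1 j)//= lerDl sumr_ge0// => k _; exact: weight_ge0.
Qed.

Lemma weight_continuous j : continuous (fun a : worldview R n => a j).
Proof.
move=> a; apply: (@continuous_comp _ _ _ set_val (fun v : 'rV[R]_n.+1 => v ord0 j)).
  exact: initial_continuous.
exact: coord_continuous.
Qed.

Lemma measurable_weight j : measurable_fun setT (fun a : worldview R n => a j).
Proof.
apply: (measurability _ (RGenOpens.measurableE R)) => _ [_ [x [y ->]] <-].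
rewrite setTI; apply: sub_sigma_algebra.
have /continuousP := @weight_continuous j; apply; exact: interval_open.
Qed.

Lemma worldview_eq a b : (forall j, a j = b j) -> a = b.
Proof. by move=> ab; apply/val_inj/rowP => j; exact: ab. Qed.

(** Finitely many measurable weights determine a worldview. *)
Lemma measurable_singleton a : measurable [set a].
Proof.
rewrite (_ : [set a] = \bigcap_(j in [set: 'I_n.+1]) ((@weight R n)^~ j @^-1` [set a j])).
  apply: fin_bigcap_measurable => // j _; rewrite -[X in measurable X]setTI.
  by apply: measurable_weight => //; exact: measurable_set1.
apply/seteqP; split=> [_ -> //|b ab]; apply: worldview_eq => j; exact: ab.
Qed.

Lemma pureE (i j : 'I_n.+1) : pure R i j = (j == i)%:R :> R.
Proof. by rewrite /weight set_valE /= mxE eqxx. Qed.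

Lemma barycenterE j : barycenter R n j = n.+1%:R^-1.
Proof. by rewrite /weight set_valE /= mxE. Qed.

Lemma weight_eq1 a i : a i = 1 -> a = pure R i.
Proof.
move=> ai; apply: worldview_eq => j; rewrite pureE; case: eqVneq => [->//|ji].
apply/eqP; rewrite eq_le weight_ge0 andbT.
have := sum_weight a; rewrite (bigD1 i)//= ai (bigD1 j)//=.
have : 0 <= \sum_(k | (k != i) && (k != j)) a k.
  by apply: sumr_ge0 => k _; exact: weight_ge0.
lra.
Qed.

Lemma measurable_discrete d (T : measurableType d) (f : action X -> T) :
  measurable_fun setT f.
Proof. by []. Qed.

Lemma measurable_utility2 :
  measurable_fun setT (fun z : worldview R n * action X => utility u z.1 z.2).
Proof.
apply: measurable_sum => j; apply: measurable_funM.
  exact: (measurableT_comp (measurable_weight j) measurable_fst).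
exact: (measurableT_comp (measurable_discrete (u j : action X -> R)) measurable_snd).
Qed.

Lemma measurable_utility x : measurable_fun setT (utility u ^~ x).
Proof.
by apply: measurable_sum => j; apply: measurable_funM => //; exact: measurable_weight.
Qed.

(** A crude uniform bound on all utilities; it also serves as their Lipschitz constant for
    [dist1]. *)
Definition payoff_bound : R := \sum_j \sum_x `|u j x|.

Lemma utility_bound a x : `|utility u a x| <= payoff_bound.
Proof.
apply: le_trans (ler_norm_sum _ _ _) _; apply: ler_sum => j _.
rewrite normrM ger0_norm ?weight_ge0//.
apply: (@le_trans _ _ `|u j x|); first by rewrite ler_piMl// weight_le1.
by rewrite (bigD1 x)//= lerDl sumr_ge0.
Qed.

Lemma zstar_exists a : exists x, zstar u a x.
Proof.
exists [arg max_(y > (point : X)) utility u a y]%O => y.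
by case: arg_maxP => // x _; exact.
Qed.

Lemma hmaxE a x : zstar u a x -> hmax u a = utility u a x.
Proof.
move=> ax; apply/eqP; rewrite eq_le; apply/andP; split.
  by apply: sup_le_ub; [exists (utility u a x), x|move=> _ [y _ <-]].
by apply: ub_le_sup; [exists (utility u a x) => _ [y _ <-]|exists x].
Qed.

Lemma utility_le_hmax a x : utility u a x <= hmax u a.
Proof. by have [y ay] := zstar_exists a; rewrite (hmaxE ay). Qed.

Lemma hmax_bound a : `|hmax u a| <= payoff_bound.
Proof. by have [x /hmaxE ->] := zstar_exists a; exact: utility_bound. Qed.

Lemma hmax_bigmax a :
  hmax u a = \big[Num.max/utility u a point]_(x <- enum X) utility u a x.
Proof.
have [x ax] := zstar_exists a; rewrite (hmaxE ax); apply/eqP; rewrite eq_le.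
rewrite le_bigmax_seq ?mem_enum//=; apply: bigmax_le => [|y _]; exact: ax.
Qed.

Lemma measurable_hmax : measurable_fun setT (hmax u).
Proof.
rewrite (_ : hmax u = fun a =>
  \big[Num.max/utility u a point]_(x <- enum X) utility u a x); last first.
  by apply/funext => a; exact: hmax_bigmax.
elim: (enum X) => [|x s IH].
  by under eq_fun do rewrite big_nil; exact: measurable_utility.
under eq_fun do rewrite big_cons.
by apply: measurable_maxr => //; exact: measurable_utility.
Qed.

Lemma measurable_zstar x : measurable [set a | zstar u a x].
Proof.
rewrite (_ : [set a | _] =
    (fun a => hmax u a - utility u a x) @^-1` [set 0]).
  rewrite -[X in measurable X]setTI.
  have mf : measurable_fun setT (fun a => hmax u a - utility u a x).
    by apply: measurable_funB; [exact: measurable_hmax|exact: measurable_utility].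
  by apply: mf => //; exact: measurable_set1.
apply/seteqP; split=> [a ax|a /= /eqP]; first by rewrite /= (hmaxE ax) subrr.
by rewrite subr_eq0 => /eqP ax y; rewrite -ax utility_le_hmax.
Qed.

Lemma qval_zstar lambda a b x : zstar u b x ->
  qval u lambda a b x = (1 - lambda) * hmax u b + lambda * utility u a x.
Proof. by move=> bx; rewrite /qval (hmaxE bx). Qed.

Lemma qval_bound lambda a b x : 0 < lambda -> lambda < 1 ->
  `|qval u lambda a b x| <= payoff_bound.
Proof.
move=> l0 l1; rewrite (le_trans (ler_normD _ _))// !normrM.
have l1' : 0 <= 1 - lambda by rewrite subr_ge0 ltW.
rewrite (ger0_norm l1') (gtr0_norm l0).
have h1 : (1 - lambda) * `|utility u b x| <= (1 - lambda) * payoff_bound.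
  by rewrite ler_wpM2l// utility_bound.
have h2 : lambda * `|utility u a x| <= lambda * payoff_bound.
  by rewrite ler_wpM2l ?utility_bound// ltW.
lra.
Qed.

End model_facts.

Lemma historyT d (S : measurableType d) t : history t [set: traj S].
Proof. by rewrite -(setD0 setT); apply: sigma_algebraCD; exact: sigma_algebra0. Qed.

(** * From the kernel to the random path *)

Section law_facts.
Context (R : realType) (n : nat) (X : pfinType) (Pi : strategy R n X).
Implicit Types (a b : worldview R n) (A : set (worldview R n)).
Implicit Types (B : set (action X * worldview R n)%type).
Local Notation path := (traj (action X * worldview R n)%type).

Lemma history_state b t A : measurable A -> history t [set w : path | A (state b t w)].
Proof.
case: t => [|t] mA.
  have [Ab|nAb] := pselect (A b).
    rewrite (_ : [set w : path | _] = setT); first exact: historyT.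
    by apply/seteqP; split.
  rewrite (_ : [set w : path | _] = set0); first exact: sigma_algebra0.
  by apply/seteqP; split.
apply: sub_sigma_algebra; exists t, (snd @^-1` A); split => //=.
by rewrite -[X in measurable X]setTI; exact: measurable_snd.
Qed.

Lemma law_outcome b t B : measurable B ->
  law Pi b [set w : path | B (w t)] = (\int[law Pi b]_w Pi (state b t w) B)%E.
Proof.
move=> mB; rewrite -(lawP Pi b _ mB) ?setTI//; exact: historyT.
Qed.

(** The conditional law integrates [Pi (state b t w) B = 0] over the event that the state in period
    [t] lies in [A]. This carries null sets of the kernel over to paths. *)
Lemma law_null b t A B : measurable A -> measurable B ->
  (forall a, A a -> Pi a B = 0%E) ->
  {ae law Pi b, forall w, A (state b t w) -> ~ B (w t)}.
Proof.
move=> mA mB AB.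
have hA := @history_state b t A mA.
have P0 : law Pi b ([set w : path | A (state b t w)] `&` [set w : path | B (w t)]) = 0%E.
  rewrite (lawP Pi b hA mB); apply: integral0_eq => w Aw; exact: AB.
exists ([set w : path | A (state b t w)] `&` [set w : path | B (w t)]); split => //.
  apply: measurableI; first exact: history_measurable hA.
  by rewrite -[X in measurable X]setTI; exact: measurable_coord.
by move=> w /= /not_implyP[Aw]; rewrite notK.
Qed.

Lemma kernel_complement0 a B : measurable B -> Pi a B = 1%E -> Pi a (~` B) = 0%E.
Proof.
move=> mB B1.
have : (Pi a setT = Pi a B + Pi a (~` B))%E.
  by rewrite -(setUv B); apply: measureU; rewrite ?setICr//; exact: measurableC.
have -> : Pi a setT = 1%E := prob_kernel a.
rewrite B1; case: (Pi a (~` B)) => [r| |]//= [rE]; congr (_%:E); lra.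
Qed.

End law_facts.

(** * Values of a strategy with optimal actions *)

Section values.
Context (R : realType) (n : nat) (X : pfinType) (u : 'I_n.+1 -> X -> R).
Context (delta lambda : R).
Hypotheses (delta_gt0 : 0 < delta) (delta_lt1 : delta < 1).
Hypotheses (lambda_gt0 : 0 < lambda) (lambda_lt1 : lambda < 1).
Variable Pi : strategy R n X.
Hypothesis Pi_opt : forall a, action_marginal Pi a (zstar u a) = 1%E.
Implicit Types (a b : worldview R n) (g : worldview R n -> R) (B V : R).
Local Notation path := (traj (action X * worldview R n)%type).
Local Notation bound := (payoff_bound u).

(** Time is countable and [X] is finite, so it suffices that for each [t] and [x] the choice of [x]
    where it is not optimal has probability zero. *)
Lemma ae_zstar b : {ae law Pi b, forall (w : path) t, zstar u (state b t w) (act t w)}.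
Proof.
apply: ae_foralln => t.
have mx (x : X) : measurable (fst @^-1` [set x] : set (action X * worldview R n)%type).
  by rewrite -[X in measurable X]setTI; exact: measurable_fst.
have : {ae law Pi b, forall w : path, forall x : X,
    (~` [set a | zstar u a x]) (state b t w) -> ~ (fst @^-1` [set x]) (w t)}.
  apply: filter_forall => x.
  apply: law_null => //; first by apply: measurableC; exact: measurable_zstar.
  move=> a nax.
  have : Pi a (~` (fst @^-1` (zstar u a : set (action X)))) = 0%E.
    apply: kernel_complement0; last exact: Pi_opt.
    by rewrite -[X in measurable X]setTI; exact: measurable_fst.
  apply: subset_measure0 => //.
    by apply: measurableC; rewrite -[X in measurable X]setTI; exact: measurable_fst.
  by move=> s /= ->.
apply: filterS => w /(_ (act t w)) h.
by apply: contrapT => nz; exact: (h nz).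
Qed.

Definition period_value a b k : R :=
  Rintegral (law Pi b) setT (fun w : path => qval u lambda a (state b k w) (act k w)).

Lemma measurable_reward a b k : measurable_fun setT
  (fun w : path => qval u lambda a (state b k w) (act k w)).
Proof.
have ma : measurable_fun setT (fun w : path => (w k).1).
  exact: (measurableT_comp measurable_fst (@measurable_coord _ _ k)).
have mp : measurable_fun setT (fun w : path => (state b k w, (w k).1)).
  by apply: measurable_fun_pair => //; exact: measurable_state.
apply: measurable_funD; apply: measurable_funM => //.
  exact: (measurableT_comp (measurable_utility2 u) mp).
exact: (measurableT_comp (measurable_discrete (utility u a : action X -> R)) ma).
Qed.

(** Expected period payoff in state [b]: for an optimal action the utility at [b] is [hmax u b], so
    only the second term depends on the draw. *)
Definition stage_value a b : R :=
  (1 - lambda) * hmax u b +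
  lambda * Rintegral (Pi b) setT (fun s => utility u a s.1).

(** The Markov operator of the worldview process. *)
Definition transition (g : worldview R n -> R) b : R :=
  Rintegral (Pi b) setT (g \o snd).

Let lambda_comb (x y B : R) : `|x| <= B -> `|y| <= B ->
  `|(1 - lambda) * x + lambda * y| <= B.
Proof.
rewrite !ler_norml => /andP[x1 x2] /andP[y1 y2].
have l1' : 0 <= 1 - lambda by rewrite subr_ge0 ltW.
have := ler_wpM2l l1' x1; have := ler_wpM2l l1' x2.
have := ler_wpM2l (ltW lambda_gt0) y1; have := ler_wpM2l (ltW lambda_gt0) y2.
by move=> *; apply/andP; split; lra.
Qed.

Let measurable_utility_fst a :
  measurable_fun setT (fun s : action X * worldview R n => utility u a s.1).
Proof.
exact: (measurableT_comp (measurable_discrete (utility u a : action X -> R)) measurable_fst).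
Qed.

Lemma measurable_stage_value a : measurable_fun setT (stage_value a).
Proof.
apply: measurable_funD; apply: measurable_funM => //; first exact: measurable_hmax.
apply: (measurable_Rintegral_kernel _ (B := bound)) => // s; exact: utility_bound.
Qed.

Lemma stage_value_bound a b : `|stage_value a b| <= bound.
Proof.
apply: lambda_comb; first exact: hmax_bound.
by apply: (Rintegral_bound (prob_kernel b)) => // s; exact: utility_bound.
Qed.

Lemma measurable_transition g B : measurable_fun setT g -> (forall b, `|g b| <= B) ->
  measurable_fun setT (transition g).
Proof.
move=> mg gB; apply: (measurable_Rintegral_kernel _ (B := B)) => [|s]; last exact: gB.
exact: (measurableT_comp mg measurable_snd).
Qed.

Lemma transition_bound g B : measurable_fun setT g -> (forall b, `|g b| <= B) ->
  forall b, `|transition g b| <= B.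
Proof.
move=> mg gB b; apply: (Rintegral_bound (prob_kernel b)) => [|s]; last exact: gB.
exact: (measurableT_comp mg measurable_snd).
Qed.

Lemma Rintegral_state b k g B : measurable_fun setT g -> (forall b, `|g b| <= B) ->
  Rintegral (law Pi b) setT (g \o state b k) = iter k transition g b.
Proof.
elim: k g => [|k IH] g mg gB; first exact: (Rintegral_cst1 (probability_setT _) (g b)).
(* The last of the [k.+1] transitions is absorbed into the function, so the induction hypothesis is
   applied to [transition g]. *)
rewrite iterSr -IH; [|exact: measurable_transition gB|exact: transition_bound].
rewrite -[LHS]/(Rintegral _ setT ((g \o snd) \o (fun w : path => w k))).
rewrite (Rintegral_conditional (K := Pi) (measurable_coord k) (measurable_state b k)
  _ _ (B := B))//.
- by move=> A mA; exact: law_outcome.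
- exact: (measurableT_comp mg measurable_snd).
- by move=> s; exact: gB.
Qed.

(** Optimality of the action turns the first term of the payoff into a function of the state;
    conditioning on the past does the same for the second term. What remains is the expectation of
    [stage_value a] at the state. *)
Lemma period_valueE a b k : period_value a b k = iter k transition (stage_value a) b.
Proof.
rewrite -(Rintegral_state _ _ (measurable_stage_value a) (stage_value_bound a)).
have P1 : law Pi b setT = 1%E := probability_setT _.
have mh : measurable_fun setT (fun w : path => hmax u (state b k w)).
  exact: (measurableT_comp (measurable_hmax u) (measurable_state b k)).
have mU : measurable_fun setT (fun w : path => utility u a (w k).1).
  exact: (measurableT_comp (measurable_utility_fst a) (@measurable_coord _ _ k)).
have mK : measurable_fun setT
    (fun b => Rintegral (Pi b) setT (fun s => utility u a s.1)).
  exact: (measurable_Rintegral_kernel Pi (measurable_utility_fst a)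
    (fun=> utility_bound _ _ _)).
have mKs : measurable_fun setT (fun w : path =>
    Rintegral (Pi (state b k w)) setT (fun s => utility u a s.1)).
  exact: (measurableT_comp mK (measurable_state b k)).
have hi := bounded_integrable P1 mh (fun=> hmax_bound _ _).
have Ui := bounded_integrable P1 mU (fun=> utility_bound _ _ _).
have Ki : (law Pi b).-integrable setT (EFin \o (fun w : path =>
    Rintegral (Pi (state b k w)) setT (fun s => utility u a s.1))).
  apply: (bounded_integrable P1 mKs (B := bound)) => w /=.
  apply: (Rintegral_bound (prob_kernel _)) => // s; exact: utility_bound.
rewrite /period_value (@ae_eq_Rintegral _ _ _ _ _ (fun w : path =>
    (1 - lambda) * hmax u (state b k w) + lambda * utility u a (w k).1)).
- rewrite /stage_value/= RintegralD//; last 2 first.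
  + exact: (integrableZl measurableT _ hi).
  + exact: (integrableZl measurableT _ Ui).
  rewrite [RHS]RintegralD//; last 2 first.
  + exact: (integrableZl measurableT _ hi).
  + exact: (integrableZl measurableT _ Ki).
  rewrite !RintegralZl//; congr (_ + _ * _).
  apply: (Rintegral_conditional (K := Pi) (measurable_coord k) (measurable_state b k)
    _ (measurable_utility_fst a) (B := bound)).
  + by move=> A mA; exact: law_outcome.
  + by move=> s; exact: utility_bound.
- exact: measurable_reward.
- by apply: measurable_funD; apply: measurable_funM.
- by apply: filterS (ae_zstar b) => w wz; exact: qval_zstar.
Qed.

Lemma period_value_bound a b k : `|period_value a b k| <= bound.
Proof.
apply: (Rintegral_bound (probability_setT _)); first exact: measurable_reward.
by move=> w; exact: qval_bound.
Qed.

(** [law] is chosen separately for each initial state, so measurability in [b] is read off from the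
    iterates of [transition]. *)
Lemma measurable_period_value a k : measurable_fun setT (fun b => period_value a b k).
Proof.
rewrite (_ : (fun b => _) = iter k transition (stage_value a)); last first.
  by apply/funext => b; exact: period_valueE.
suff : measurable_fun setT (iter k transition (stage_value a)) /\
  forall b, `|iter k transition (stage_value a) b| <= bound by case.
elim: k => [|k [IH1 IH2]]; first by split;
  [exact: measurable_stage_value|exact: stage_value_bound].
by split; [exact: measurable_transition IH2|exact: transition_bound].
Qed.

Lemma continuationE b a :
  continuation u delta lambda Pi b a = (discounted delta (period_value a b))%:E.
Proof.
rewrite /continuation unlock.
apply: (Rintegral_discounted delta_gt0 delta_lt1 (B := bound)).
- exact: probability_setT.
- by move=> k; exact: measurable_reward.
- by move=> k w; exact: qval_bound.
Qed.

(** Drawing the initial state from the marginal at [a] amounts to one more transition, hence the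
    shift to [k.+1]. *)
Lemma chosen_valueE a : chosen_value u delta lambda Pi a =
  (discounted delta (fun k => period_value a a k.+1))%:E.
Proof.
rewrite /chosen_value.
under eq_integral do rewrite continuationE.
rewrite (Rintegral_discounted delta_gt0 delta_lt1 (B := bound)
  (f := fun k b => period_value a b k)); first last.
- by move=> k b; exact: period_value_bound.
- by move=> k; exact: measurable_period_value.
- exact: (prob_kernel a).
congr (_%:E); apply: eq_discounted => k.
rewrite [RHS]period_valueE iterS /transition.
rewrite (_ : iter _ _ _ = (fun b => period_value a b k)); last first.
  by apply/funext => b; rewrite period_valueE.
congr fine; rewrite (integral_pushforward measurable_snd)//.
  by apply/measurable_EFinP; exact: measurable_period_value.
apply: (bounded_integrable (prob_kernel a) (B := bound)).
  exact: (measurableT_comp (measurable_period_value a k) measurable_snd).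
by move=> s; exact: period_value_bound.
Qed.

Lemma period_value_le a b V k :
  (forall b x, zstar u b x -> qval u lambda a b x <= V) ->
  period_value a b k <= V /\ (period_value a b k = V ->
   {ae law Pi b, forall w : path, qval u lambda a (state b k w) (act k w) = V}).
Proof.
move=> qV; apply: (ae_eq_Rintegral_max (probability_setT _)).
  apply: (bounded_integrable (probability_setT _) (B := bound)).
    exact: measurable_reward.
  by move=> w; exact: qval_bound.
by apply: filterS (ae_zstar b) => w wz; exact: qV.
Qed.

Lemma period_value_cst a b V k :
  {ae law Pi b, forall w : path, qval u lambda a (state b k w) (act k w) = V} ->
  period_value a b k = V.
Proof.
move=> h; rewrite -[RHS](Rintegral_cst1 (probability_setT (law Pi b)) V).
by apply: ae_eq_Rintegral => //; exact: measurable_reward.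
Qed.

Lemma period_value0 a : period_value a a 0 = hmax u a.
Proof.
apply: period_value_cst; apply: filterS (ae_zstar a) => w /(_ 0%N) wz.
by rewrite (qval_zstar _ _ wz) (hmaxE wz) /=; ring.
Qed.

Lemma discounted_period_value_le a b V :
  (forall b x, zstar u b x -> qval u lambda a b x <= V) ->
  discounted delta (period_value a b) <= V / (1 - delta).
Proof.
move=> qV; have [+ _] := le_discounted delta_gt0 delta_lt1
  (fun k => period_value_bound a b k) (fun k => (period_value_le b k qV).1).
exact.
Qed.

(* The chosen continuation value cannot exceed V / (1 - delta), so reaching it
   forces the period payoff V in every period. *)
Lemma ae_qval_eq a V :
  (forall b x, zstar u b x -> qval u lambda a b x <= V) ->
  ((V / (1 - delta))%:E <= chosen_value u delta lambda Pi a)%E ->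
  {ae law Pi a, forall (w : path) t, (1 <= t)%N ->
    qval u lambda a (state a t w) (act t w) = V}.
Proof.
move=> qV; rewrite chosen_valueE lee_fin => VS.
have [_ h] := le_discounted delta_gt0 delta_lt1
  (fun k => period_value_bound a a k.+1) (fun k => (period_value_le a k.+1 qV).1).
apply: ae_foralln => -[|k]; first exact: aeW.
by apply: filterS ((period_value_le a k.+1 qV).2 (h VS k)) => w.
Qed.

Lemma chosen_value_ge_hmax a :
  (forall b, (continuation u delta lambda Pi b a <= chosen_value u delta lambda Pi a)%E) ->
  ((hmax u a / (1 - delta))%:E <= chosen_value u delta lambda Pi a)%E.
Proof.
move=> /(_ a); rewrite continuationE chosen_valueE !lee_fin.
rewrite (discounted_recl delta_gt0 delta_lt1 (period_value_bound a a)).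
rewrite period_value0; set D := discounted _ _ => hD.
(* [D] is the chosen value, and the deviation to [a] itself gives [hmax u a + delta * D <= D]. *)
by rewrite ler_pdivrMr ?subr_gt0//; lra.
Qed.

End values.

(** * Almost sure consequences of equilibrium *)

Section equilibrium.
Context (R : realType) (n : nat) (X : pfinType) (u : 'I_n.+1 -> X -> R).
Context (delta lambda : R).
Hypotheses (delta_gt0 : 0 < delta) (delta_lt1 : delta < 1).
Hypotheses (lambda_gt0 : 0 < lambda) (lambda_lt1 : lambda < 1).
Implicit Types (a b : worldview R n) (Pi : strategy R n X).
Local Notation path := (traj (action X * worldview R n)%type).

Lemma mpe_ae_zstar Pi b : stationary_MPE u delta lambda Pi ->
  {ae law Pi b, forall (w : path) t, zstar u (state b t w) (act t w)}.
Proof. by move=> mpe; apply: ae_zstar => a; have [] := mpe a. Qed.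

(** The deviation to [a] itself secures [hmax u a], which by hypothesis is also the upper bound.
    Period [0] is included, since there both utilities are taken at [a]. *)
Lemma mpe_ae_qval a Pi :
  (forall b x, zstar u b x -> qval u lambda a b x <= hmax u a) ->
  stationary_MPE u delta lambda Pi ->
  {ae law Pi a, forall (w : path) t,
    qval u lambda a (state a t w) (act t w) = hmax u a}.
Proof.
move=> qh mpe.
have opt b : action_marginal Pi b (zstar u b) = 1%E by have [] := mpe b.
have h : {ae law Pi a, forall (w : path) t, (1 <= t)%N ->
    qval u lambda a (state a t w) (act t w) = hmax u a}.
  apply: (ae_qval_eq delta_gt0 delta_lt1) => //.
  by apply: chosen_value_ge_hmax => // b; have [_] := mpe a; exact.
apply: filterS2 h (ae_zstar opt a) => w h wz [|t]; last exact: h.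
by rewrite (qval_zstar _ _ (wz 0%N)) (hmaxE (wz 0%N)) /=; ring.
Qed.

End equilibrium.

(** * Distances between sets of worldviews *)

Section distances.
Context (R : realType) (n : nat).
Implicit Types (a b : worldview R n) (A B : set (worldview R n)).

Lemma dist1_ge0 a b : 0 <= dist1 a b.
Proof. by apply: sumr_ge0. Qed.

Lemma le_dist1_to a B (e : R) : B !=set0 ->
  (forall b, B b -> e <= dist1 a b) -> e <= dist1_to a B.
Proof.
move=> [b0 Bb0] eB; apply: lb_le_inf; first by exists (dist1 a b0), b0.
by move=> _ [b Bb <-]; exact: eB.
Qed.

Lemma le_dist1_sets A B (e : R) : A !=set0 -> B !=set0 ->
  (forall a b, A a -> B b -> e <= dist1 a b) -> e <= dist1_sets A B.
Proof.
move=> [a0 Aa0] [b0 Bb0] eAB; apply: lb_le_inf.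
  by exists (dist1 a0 b0), a0 => //; exists b0.
by move=> _ [a Aa [b Bb <-]]; exact: eAB.
Qed.

Lemma dist1_sets_le A B a b : A a -> B b -> dist1_sets A B <= dist1 a b.
Proof.
move=> Aa Bb; apply: ge_inf; last by exists a => //; exists b.
by exists 0 => _ [a' _ [b' _ <-]]; exact: dist1_ge0.
Qed.

Lemma pures_nonempty : pures R n !=set0.
Proof. by exists (pure R ord0), ord0. Qed.

Lemma dist1_sets_le_to A B a : A a -> B !=set0 -> dist1_sets A B <= dist1_to a B.
Proof. by move=> Aa B0; apply: le_dist1_to => // b Bb; exact: dist1_sets_le. Qed.

(** The weight [1 - a i] is missing at [i] and spread over the other coordinates, so it counts
    twice. *)
Lemma dist1_pure a i : dist1 a (pure R i) = 2 * (1 - a i).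
Proof.
rewrite /dist1 (bigD1 i)//= pureE eqxx.
rewrite ler0_norm ?subr_le0 ?weight_le1//.
under eq_bigr => j ji do rewrite pureE (negbTE ji) subr0 ger0_norm ?weight_ge0//.
have := sum_weight a; rewrite (bigD1 i)//=.
set s := \sum_(j | _) _ => as1; lra.
Qed.

Lemma finite_pos_lower_bound (I : finType) (e : I -> R) :
  (forall i, 0 < e i) -> exists2 d, 0 < d & forall i, d <= e i.
Proof.
move=> e0; exists (\big[Num.min/1]_i e i).
  by apply: lt_bigmin => //; exact: ltr01.
by move=> i; apply: bigmin_le_cond.
Qed.

Context (X : pfinType) (u : 'I_n.+1 -> X -> R).

Lemma utility_lipschitz a b (x : X) :
  `|utility u a x - utility u b x| <= payoff_bound u * dist1 a b.
Proof.
rewrite /utility -sumrB mulr_sumr; apply: le_trans (ler_norm_sum _ _ _) _.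
apply: ler_sum => j _; rewrite -mulrBl normrM mulrC ler_wpM2r//.
rewrite /payoff_bound (bigD1 j)//= (bigD1 x)//= -addrA lerDl addr_ge0//.
  by apply: sumr_ge0.
by apply: sumr_ge0 => k _; apply: sumr_ge0.
Qed.

Variable lambda : R.
Hypotheses (lambda_gt0 : 0 < lambda) (lambda_lt1 : lambda < 1).

(** Each of the finitely many pairs of a pure worldview and an action gets its own separation
    constant; the distance is at least a common positive lower bound of these. *)
Lemma dist1_Kset_pures_gt0 a : Kset u lambda a `&` pures R n = set0 ->
  0 < dist1_sets (Kset u lambda a) (pures R n).
Proof.
move=> KP.
(* The added [1] makes [L] positive, so that it can be divided by. *)
pose L := payoff_bound u + 1.
have L0 : 0 < L.
  by rewrite /L ltr_wpDl// /payoff_bound; do 2 (apply: sumr_ge0 => ? _).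
have lip b b' x : `|utility u b x - utility u b' x| <= L * dist1 b b'.
  apply: le_trans (utility_lipschitz b b' x) _.
  by rewrite ler_wpM2r ?dist1_ge0// /L lerDl.
have ex (ix : 'I_n.+1 * X) : exists e : R, 0 < e /\ forall b,
    zstar u b ix.2 -> qval u lambda a b ix.2 = hmax u a -> e <= dist1 b (pure R ix.1).
  case: ix => i x /=; set p := pure R i.
  have [px|/existsNP[y /negP]] := pselect (zstar u p x).
    have qp : qval u lambda a p x != hmax u a.
      apply/eqP => qp; have : (Kset u lambda a `&` pures R n) p.
        by split; [exists x|exists i].
      by rewrite KP.
    (* Since [p] is outside [Kset], there is a positive payoff gap at [p], and for fixed [x] the
       payoff is [L]-Lipschitz in the worldview. *)
    exists (`|qval u lambda a p x - hmax u a| / L); split.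
      by rewrite divr_gt0// normr_gt0 subr_eq0.
    move=> b bx <-; rewrite ler_pdivrMr// mulrC.
    have -> : qval u lambda a p x - qval u lambda a b x =
        (1 - lambda) * (utility u p x - utility u b x) by rewrite /qval; ring.
    rewrite normrM (distrC (utility u p x)); apply: le_trans (lip b p x).
    have l1 : 0 <= 1 - lambda by rewrite subr_ge0 ltW.
    by rewrite (ger0_norm l1) ler_piMl// gerBl ltW.
  rewrite -ltNge => xy.
  (* The action [x] is beaten by [y] at [p]. For [x] to be optimal at [b], the two utilities
     together must move by the gap, each by at most [L * dist1 b p]. *)
  exists ((utility u p y - utility u p x) / (2 * L)); split.
    by rewrite divr_gt0 ?subr_gt0// mulr_gt0.
  move=> b /(_ y) bx _; rewrite ler_pdivrMr ?mulr_gt0//.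
  have := lip b p x; have := lip b p y; rewrite !ler_norml.
  move=> /andP[h1 h2] /andP[h3 h4]; lra.
have /choice[e eP] := ex.
have [d d0 de] := finite_pos_lower_bound (fun ix => (eP ix).1).
apply: lt_le_trans d0 _; apply: le_dist1_sets; last 2 first.
- exact: pures_nonempty.
- by move=> b _ [x bx qb] [i _ <-]; apply: le_trans (de (i, x)) _; apply: (eP (i, x)).2.
(* [a] lies in its own [Kset], which is therefore nonempty, as a lower bound on the infimum
   requires. *)
- have [x ax] := zstar_exists u a; exists a, x => //.
  by rewrite (qval_zstar _ _ ax) (hmaxE ax); ring.
Qed.

End distances.

(** * Deterministic strategies *)

(** The preimage of any set is a finite union of cells on which all tests are constant, so [F] may
    be arbitrary. *)
Lemma measurable_finite_tests d d' (T : measurableType d) (Z : measurableType d')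
    (K : finType) (A : K -> set T) (F : {ffun K -> bool} -> Z) :
  (forall i, measurable (A i)) ->
  measurable_fun setT (fun t => F [ffun i => `[< A i t >]]).
Proof.
move=> mA _ B _; rewrite setTI.
rewrite (_ : _ @^-1` B = \bigcup_(v in [set v | B (F v)])
    \bigcap_(i in [set: K]) (if v i then A i else ~` A i)).
  apply: fin_bigcup_measurable => // v _; apply: fin_bigcap_measurable => // i _.
  by case: (v i) => //; exact: measurableC.
apply/seteqP; split=> [t Bt|t [v Bv vt]].
  by exists [ffun i => `[< A i t >]] => // i _; rewrite ffunE; case: asboolP.
rewrite /preimage/= (_ : [ffun i => _] = v)//; apply/ffunP => i; rewrite ffunE.
by have := vt i I; case: (v i) => h; [exact/asboolP|exact/asboolPn].
Qed.

Section deterministic.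
Context (R : realType) (n : nat) (X : pfinType) (u : 'I_n.+1 -> X -> R).
Context (delta lambda : R).
Hypotheses (delta_gt0 : 0 < delta) (delta_lt1 : delta < 1).
Hypotheses (lambda_gt0 : 0 < lambda) (lambda_lt1 : lambda < 1).
Implicit Types (a b : worldview R n).
Local Notation path := (traj (action X * worldview R n)%type).

Lemma measurable_optimal_action : exists phi : worldview R n -> action X,
  measurable_fun setT phi /\ forall a, zstar u a (phi a).
Proof.
(* The choice depends only on finitely many comparisons of utilities. The default [point] is never
   reached, since an optimal action exists. *)
pose F (v : {ffun X * X -> bool}) : action X :=
  odflt point [pick x | [forall y, v (y, x)]].
pose A (xy : X * X) := [set a : worldview R n | utility u a xy.1 <= utility u a xy.2].
exists (fun a => F [ffun xy => `[< A xy a >]]); split.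
  apply: measurable_finite_tests => -[x y]; rewrite /A /=.
  rewrite -[X in measurable X]setTI; apply: measurable_fun_le => //;
    exact: measurable_utility.
move=> a; rewrite /F; case: pickP => [x /forallP h y|].
  by have := h y; rewrite ffunE => /asboolP.
have [x ax] := zstar_exists u a => /(_ x) /negP[]; apply/forallP => y.
by rewrite ffunE; apply/asboolP; exact: ax.
Qed.

Variable f : worldview R n -> (action X * worldview R n)%type.
Hypothesis mf : measurable_fun setT f.

Definition deterministic : strategy R n X := kdirac mf.

Hypothesis f_opt : forall a, zstar u a (f a).1.
(** A target is its own target: the process moves once and then rests. *)
Hypothesis f_idem : forall a, (f (f a).2).2 = (f a).2.

Let measurable_fst1 (x : action X) :
  measurable (fst @^-1` [set x] : set (action X * worldview R n)%type).
Proof. by rewrite -[X in measurable X]setTI; exact: measurable_fst. Qed.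

Let measurable_snd1 b : measurable (snd @^-1` [set b] : set (action X * worldview R n)%type).
Proof.
rewrite -[X in measurable X]setTI; apply: measurable_snd => //; exact: measurable_singleton.
Qed.

(** The exceptional null set depends on [a], which is harmless: almost surely only [b] and its
    target are visited. *)
Lemma deterministic_step b a t : {ae law deterministic b, forall w : path,
  state b t w = a -> act t w = (f a).1 /\ state b t.+1 w = (f a).2}.
Proof.
have mB : measurable ((fst @^-1` [set (f a).1] `&` snd @^-1` [set (f a).2])
    : set (action X * worldview R n)%type) by exact: measurableI.
have := @law_null R n X deterministic b t [set a] (~` _)
  (measurable_singleton a) (measurableC mB).
have h a' : [set a] a' -> deterministic a'
    (~` (fst @^-1` [set (f a).1] `&` snd @^-1` [set (f a).2])) = 0%E.
  move=> ->; rewrite /deterministic /= /kdirac /= diracE memNset//=.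
  by apply; split.
by move=> /(_ h); apply: filterS => w hw /hw /contrapT.
Qed.

Lemma deterministic_state b : {ae law deterministic b, forall (w : path) t,
  (1 <= t)%N -> act t w = (f (f b).2).1 /\ state b t w = (f b).2}.
Proof.
have s0 := deterministic_step b b 0.
have st : {ae law deterministic b, forall (w : path) t, state b t w = (f b).2 ->
    act t w = (f (f b).2).1 /\ state b t.+1 w = (f (f b).2).2}.
  by apply: ae_foralln => t; exact: deterministic_step.
apply: filterS2 s0 st => w /(_ erefl)[_ w1] wt.
have ws t : state b t.+1 w = (f b).2.
  by elim: t => [//|t IH]; have [_ ->] := wt _ IH.
by move=> [//|t] _; split; [have [] := wt _ (ws t)|exact: ws].
Qed.

(** The chosen continuation pays the constant [V] in every period, and by hypothesis no deviation
    pays more than [V] in any period. *)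
Lemma deterministic_MPE :
  (forall a b x, zstar u b x ->
     qval u lambda a b x <= qval u lambda a (f a).2 (f (f a).2).1) ->
  stationary_MPE u delta lambda deterministic.
Proof.
move=> best.
have opt a : action_marginal deterministic a (zstar u a) = 1%E.
  rewrite /action_marginal /pushforward /deterministic /= /kdirac /= diracE.
  by rewrite mem_set//; exact: f_opt.
move=> a; split=> // b.
rewrite (continuationE u delta_gt0 delta_lt1 lambda_gt0 lambda_lt1).
rewrite (chosen_valueE delta_gt0 delta_lt1 lambda_gt0 lambda_lt1 opt) lee_fin.
set V := qval u lambda a (f a).2 (f (f a).2).1.
rewrite [leRHS](@eq_discounted _ _ _ (fun=> V)); last first.
  move=> k; apply: period_value_cst => //.
  by apply: filterS (deterministic_state a) => w /(_ k.+1 isT)[-> ->].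
rewrite discounted_cst//.
by apply: (discounted_period_value_le delta_gt0 delta_lt1 lambda_gt0 lambda_lt1 opt) => ? ?;
  exact: best.
Qed.

End deterministic.

(** * One safe action c and one specialist action a_i for each worldview i *)

Section specialists.
Context (R : realType) (n : nat) (M : R) (X : pfinType).
(** The bijection between [X] and [option 'I_n.+1] names the safe action [None] and the specialists
    [Some i], so that parts (B) and (C) share one argument. *)
Context (u : 'I_n.+1 -> X -> R) (e : X -> option 'I_n.+1) (g : option 'I_n.+1 -> X).
Hypotheses (ge : cancel e g) (eg : cancel g e).
Hypothesis uE : forall j x, u j x = payoffC M j (e x).
Context (delta lambda : R).
Hypotheses (delta_gt0 : 0 < delta) (delta_lt1 : delta < 1).
Hypotheses (lambda_gt0 : 0 < lambda) (lambda_lt1 : lambda < 1).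
(** [NM] is [M > 1 / (N - 1)] without denominators. Equivalently, [1 / N] lies below [M / (1 + M)],
    the weight above which a specialist beats [c]. *)
Hypotheses (M_gt0 : 0 < M) (NM : 1 + M < n.+1%:R * M).
Implicit Types (a b : worldview R n) (i j : 'I_n.+1) (Pi : strategy R n X).
Local Notation path := (traj (action X * worldview R n)%type).
Local Notation N := (n.+1%:R : R).
Local Notation bar := (barycenter R n).
Local Notation MPE := (stationary_MPE u delta lambda).

Let M1_gt0 : 0 < 1 + M. Proof. by rewrite addr_gt0. Qed.
Let N_gt0 : 0 < N. Proof. by rewrite ltr0n. Qed.
Let N_gt1 : 1 < N.
Proof. by rewrite -(ltr_pM2r M_gt0) mul1r (lt_trans _ NM)// ltrDr. Qed.

Lemma utility_safe a : utility u a (g None) = 0.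
Proof. by rewrite /utility big1// => j _; rewrite uE eg mulr0. Qed.

Lemma utility_specialist a i : utility u a (g (Some i)) = (1 + M) * a i - M.
Proof.
rewrite /utility (bigD1 i)//= uE eg /= eqxx mulr1.
under eq_bigr => j ji do rewrite uE eg /= (negbTE ji).
rewrite -mulr_suml; have := sum_weight a; rewrite (bigD1 i)//=.
set s := \sum_(j | _) _ => as1; have -> : s = 1 - a i by rewrite -as1 [a i + s]addrC addrK.
ring.
Qed.

Lemma action_cases x : x = g None \/ exists i, x = g (Some i).
Proof. by rewrite -(ge x); case: (e x) => [i|]; [right; exists i|left]. Qed.

(* The supremum over b of the period payoff of a_i, attained only at the pure
   worldview i. *)
Definition specialist_value a i : R := 1 - lambda * (1 + M) * (1 - a i).

Lemma qval_safe a b : qval u lambda a b (g None) = 0.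
Proof. by rewrite /qval !utility_safe; ring. Qed.

(** The payoff splits into a term in [a] and a loss in [b] that vanishes only at the pure worldview
    [i]. *)
Lemma qval_specialist a b i : qval u lambda a b (g (Some i)) =
  specialist_value a i - (1 - lambda) * (1 + M) * (1 - b i).
Proof. by rewrite /qval !utility_specialist /specialist_value; ring. Qed.

Lemma qval_specialist_le a b i :
  qval u lambda a b (g (Some i)) <= specialist_value a i.
Proof.
by rewrite qval_specialist gerBl !mulr_ge0 ?subr_ge0 ?weight_le1// ltW.
Qed.

Lemma qval_specialist_eq a b i :
  qval u lambda a b (g (Some i)) = specialist_value a i -> b = pure R i.
Proof.
rewrite qval_specialist => /eqP; rewrite subr_eq addrC -subr_eq subrr eq_sym.
rewrite !mulf_eq0 !subr_eq0 gt_eqF//= (gt_eqF M1_gt0)/= => /eqP bi.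
exact: weight_eq1.
Qed.

Lemma qval_specialist_pure a i :
  qval u lambda a (pure R i) (g (Some i)) = specialist_value a i.
Proof. by rewrite qval_specialist pureE eqxx subrr mulr0 subr0. Qed.

Lemma qval_le a b x V : 0 <= V -> (forall i, specialist_value a i <= V) ->
  qval u lambda a b x <= V.
Proof.
move=> V0 aV; have [->|[i ->]] := action_cases x; first by rewrite qval_safe.
exact: le_trans (qval_specialist_le _ _ _) (aV i).
Qed.

Lemma zstar_safe a : zstar u a (g None) <-> forall i, a i <= M / (1 + M).
Proof.
have key i : (a i <= M / (1 + M)) = (utility u a (g (Some i)) <= 0).
  by rewrite utility_specialist ler_pdivlMr// subr_le0 mulrC.
split=> [h i|h y]; first by rewrite key -(utility_safe a).
rewrite utility_safe; have [->|[i ->]] := action_cases y.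
  by rewrite utility_safe.
by rewrite -key.
Qed.

Lemma zstar_pure j : zstar u (pure R j) (g (Some j)).
Proof.
move=> y; rewrite utility_specialist pureE eqxx.
have [->|[i ->]] := action_cases y; first by rewrite utility_safe /= mulr1; lra.
rewrite utility_specialist pureE; case: (_ == _) => /=; by have := M_gt0; lra.
Qed.

Lemma hmax_pure j : hmax u (pure R j) = 1.
Proof. by rewrite (hmaxE (@zstar_pure j)) utility_specialist pureE eqxx /=; ring. Qed.

Lemma specialist_value_pure i j :
  specialist_value (pure R j) i = if i == j then 1 else 1 - lambda * (1 + M).
Proof. by rewrite /specialist_value pureE; case: eqP => _ /=; ring. Qed.

Let lM_gt0 : 0 < lambda * (1 + M). Proof. exact: mulr_gt0. Qed.

(** * Pure worldviews are absorbing *)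

Lemma qval_pure_le j b x : qval u lambda (pure R j) b x <= 1.
Proof.
apply: qval_le => // i; rewrite specialist_value_pure.
by case: eqP => // _; rewrite gerBl ltW.
Qed.

(** The safe action pays [0], and any other specialist at most [1 - lambda * (1 + M) < 1]. *)
Lemma qval_pure_eq j b x :
  qval u lambda (pure R j) b x = 1 -> b = pure R j /\ x = g (Some j).
Proof.
have [->|[i ->]] := action_cases x.
  by rewrite qval_safe => /eqP; rewrite eq_sym oner_eq0.
case: (eqVneq i j) => [-> h|ij h].
  by split => //; apply: (@qval_specialist_eq (pure R j)); rewrite h specialist_value_pure eqxx.
have := qval_specialist_le (pure R j) b i.
rewrite h specialist_value_pure (negbTE ij) => h'; exfalso; have := lM_gt0; lra.
Qed.

Lemma zstar_pure_eq j x : zstar u (pure R j) x -> x = g (Some j).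
Proof.
move=> jx; have [] // := @qval_pure_eq j (pure R j) x.
rewrite (qval_zstar _ _ jx) -(hmaxE jx) hmax_pure; ring.
Qed.

(** The maximal payoff at [pure R j] bounds all period payoffs, so it is attained in every period,
    and only one pair attains it. *)
Lemma pure_stays Pi j : MPE Pi -> {ae law Pi (pure R j), forall (w : path) t,
  state (pure R j) t w = pure R j /\ act t w = g (Some j)}.
Proof.
move=> mpe.
have qj b x : zstar u b x -> qval u lambda (pure R j) b x <= hmax u (pure R j).
  by move=> _; rewrite hmax_pure; exact: qval_pure_le.
have := mpe_ae_qval delta_gt0 delta_lt1 lambda_gt0 lambda_lt1 qj mpe.
by apply: filterS => w wq t; apply: qval_pure_eq; rewrite wq hmax_pure.
Qed.

Let measurable_target b : measurable (snd @^-1` [set b] : set (action X * worldview R n)%type).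
Proof.
rewrite -[X in measurable X]setTI; apply: measurable_snd => //; exact: measurable_singleton.
Qed.

(** The kernel at [pure R j] is the law of the first outcome from there, whose second component is
    the state in period [1]. *)
Lemma pure_absorbing Pi j : MPE Pi -> state_marginal Pi (pure R j) [set pure R j] = 1%E.
Proof.
move=> mpe; have mB := measurable_target (pure R j).
transitivity (law Pi (pure R j) [set w : path | (snd @^-1` [set pure R j]) (w 0%N)]).
  rewrite law_outcome// -[LHS]mule1 -(probability_setT (law Pi (pure R j))).
  by rewrite -integral_cst.
apply: ae_probability1.
  by rewrite -[X in measurable X]setTI; exact: measurable_coord.
by apply: filterS (pure_stays j mpe) => w /(_ 1%N)[].
Qed.

(** Absorption is a property of the kernel, hence valid in every period of a path from any [b]. *)
Lemma pure_absorbed Pi b : MPE Pi -> {ae law Pi b, forall w : path,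
  pures R n (state b 1 w) -> forall t, (1 <= t)%N -> state b t w = state b 1 w}.
Proof.
move=> mpe.
have : {ae law Pi b, forall (w : path) t, forall j,
    [set pure R j] (state b t w) -> ~ (~` (snd @^-1` [set pure R j])) (w t)}.
  apply: ae_foralln => t; apply: filter_forall => j; apply: law_null.
  - exact: measurable_singleton.
  - by apply: measurableC; exact: measurable_target.
  - move=> _ ->; apply: kernel_complement0; first exact: measurable_target.
    exact: pure_absorbing.
apply: filterS => w wP [j _ jE]; elim=> // t IH _.
case: t IH => // t /(_ isT) IH.
by have /contrapT := wP t.+1 j (etrans IH (esym jE)); rewrite -jE.
Qed.

(** * Specialists at the barycenter and the subcritical case *)

Lemma specialist_value_bar i :
  specialist_value bar i = 1 - lambda * ((N - 1) * (1 + M)) / N.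
Proof.
by rewrite /specialist_value barycenterE; field; rewrite gt_eqF.
Qed.

Definition critical : R := N / ((N - 1) * (1 + M)).

Lemma specialist_value_bar_gt0 i : (0 < specialist_value bar i) = (lambda < critical).
Proof.
rewrite specialist_value_bar subr_gt0 ltr_pdivrMr// mul1r ltr_pdivlMr//.
by rewrite mulr_gt0// subr_gt0.
Qed.

Lemma specialist_value_bar_lt0 i : (specialist_value bar i < 0) = (critical < lambda).
Proof.
rewrite specialist_value_bar subr_lt0 ltr_pdivlMr// mul1r ltr_pdivrMr//.
by rewrite mulr_gt0// subr_gt0.
Qed.

Lemma specialist_value_bar_eq0 i : lambda = critical -> specialist_value bar i = 0.
Proof.
move=> lc; apply/eqP; rewrite eq_le leNgt specialist_value_bar_gt0 lc ltxx/=.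
by rewrite leNgt specialist_value_bar_lt0 lc ltxx.
Qed.

Lemma bar_lt_threshold : N^-1 < M / (1 + M).
Proof. by rewrite ltr_pdivlMr// mulrC ltr_pdivrMr// mulrC. Qed.

Lemma zstar_bar_eq x : zstar u bar x -> x = g None.
Proof.
have [->//|[i ->]] := action_cases x => /(_ (g None)).
rewrite utility_safe utility_specialist barycenterE => h.
have := bar_lt_threshold; rewrite ltr_pdivlMr// => h'; exfalso.
by move: h h'; set v := N^-1; lra.
Qed.

Lemma zstar_bar : zstar u bar (g None).
Proof. by apply/zstar_safe => i; rewrite barycenterE ltW// bar_lt_threshold. Qed.

Lemma hmax_bar : hmax u bar = 0.
Proof. by rewrite (hmaxE zstar_bar) utility_safe. Qed.

Lemma subcritical_becomes_pure Pi : MPE Pi -> lambda < critical ->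
  {ae law Pi bar, forall w : path, pures R n (state bar 1 w) /\
    forall t, (1 <= t)%N -> state bar t w = state bar 1 w}.
Proof.
move=> mpe lc; set V := specialist_value bar ord0.
have VE i : specialist_value bar i = V by rewrite /V !specialist_value_bar.
have V0 : 0 < V by rewrite specialist_value_bar_gt0.
have opt b : action_marginal Pi b (zstar u b) = 1%E by have [] := mpe b.
have q : {ae law Pi bar, forall (w : path) t, (1 <= t)%N ->
    qval u lambda bar (state bar t w) (act t w) = V}.
  apply: (ae_qval_eq delta_gt0 delta_lt1) => //.
    by move=> b x _; apply: qval_le => [|i]; rewrite ?VE// ltW.
  (* The deviation to a pure worldview stays there and pays [V] forever. *)
  apply: le_trans ((mpe bar).2 (pure R ord0)).
  rewrite (continuationE u delta_gt0 delta_lt1)// lee_fin -(discounted_cst delta_gt0)//.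
  rewrite (@eq_discounted _ _ (period_value _ _ _ _ _) (fun=> V))// => k.
  apply: period_value_cst; apply: filterS (pure_stays ord0 mpe) => w /(_ k)[-> ->].
  by rewrite qval_specialist_pure.
apply: filterS2 q (pure_absorbed bar mpe) => w wq wabs.
suff w1 : pures R n (state bar 1 w) by split => //; exact: wabs.
(* Positivity of [V] rules out [c], and a specialist reaches [V] only at its pure worldview. *)
have := wq 1%N isT; have [->|[i ->]] := action_cases (act 1 w).
  by rewrite qval_safe => V0'; rewrite -V0' ltxx in V0.
by rewrite -(VE i) => /qval_specialist_eq ->; exists i.
Qed.

(** * The trap region and the critical case *)

Lemma lt_sup_weight a z : sup (range (weight a)) < z <-> forall i, a i < z.
Proof.
have [i ai] : exists i, forall j, a j <= a i.
  exists [arg max_(j > ord0) a j]%O => j.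
  by case: arg_maxP => // i _; exact.
have -> : sup (range (weight a)) = a i.
  apply/eqP; rewrite eq_le; apply/andP; split.
    by apply: sup_le_ub; [exists (a i), i|move=> _ [j _ <-]].
  by apply: ub_le_sup; [exists (a i) => _ [j _ <-]|exists i].
by split=> [iz j|]; [exact: le_lt_trans iz|exact].
Qed.

Lemma open_weight_lt z : open [set a : worldview R n | sup (range (weight a)) < z].
Proof.
have -> : [set a : worldview R n | sup (range (weight a)) < z] =
    [set a | forall i, a i < z] by apply/seteqP; split=> a /lt_sup_weight.
rewrite openE => a az.
apply: (@filter_forall _ 'I_n.+1 (fun i (b : worldview R n) => b i < z) (nbhs a)) => i.
have : open ((fun b : worldview R n => b i) @^-1` [set y | y < z]).
  by have /continuousP := @weight_continuous R n i; apply; exact: open_lt.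
by rewrite openE => /(_ a (az i)).
Qed.

Definition trap : set (worldview R n) :=
  [set a | sup (range (weight a)) < 1 - 1 / (lambda * (1 + M))].

Lemma trapP a : trap a <-> forall i, specialist_value a i < 0.
Proof.
have key i : (a i < 1 - 1 / (lambda * (1 + M))) = (specialist_value a i < 0).
  rewrite /specialist_value subr_lt0 [X in _ = (1 < X)]mulrC -ltr_pdivrMr//.
  by rewrite ltrBrDl -ltrBrDr.
rewrite /trap /= lt_sup_weight.
by split=> h i; [rewrite -key|rewrite key].
Qed.

Lemma trap_bar : critical < lambda -> trap bar.
Proof. by move=> cl; apply/trapP => i; rewrite specialist_value_bar_lt0. Qed.

(** All period payoffs are at most [hmax u a = 0], and a specialist stays strictly below it, so only
    [c] is played; optimality of [c] then confines the state. *)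
Lemma trap_stays_safe Pi a : MPE Pi -> trap a ->
  {ae law Pi a, forall (w : path) t, [/\ act t w = g None,
     forall i, state a t w i <= M / (1 + M) &
     2 / (1 + M) <= dist1_to (state a t w) (pures R n)]}.
Proof.
move=> mpe /trapP ta.
have za : zstar u a (g None).
  (* A negative specialist value means [lambda * (1 + M) * (1 - a i) > 1]. Since [lambda < 1], also
     [(1 + M) * (1 - a i) > 1]. *)
  apply/zstar_safe => i; rewrite ler_pdivlMr//.
  have := ta i; rewrite /specialist_value => h.
  have : lambda * ((1 + M) * (1 - a i)) <= (1 + M) * (1 - a i).
    by rewrite ler_piMl ?mulr_ge0 ?subr_ge0 ?weight_le1// ltW.
  lra.
have ha : hmax u a = 0 by rewrite (hmaxE za) utility_safe.
have qa b x : zstar u b x -> qval u lambda a b x <= hmax u a.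
  by move=> _; rewrite ha; apply: qval_le => // i; exact: ltW.
have q := mpe_ae_qval delta_gt0 delta_lt1 lambda_gt0 lambda_lt1 qa mpe.
apply: filterS2 q (mpe_ae_zstar a mpe) => w wq wz t.
have wc : act t w = g None.
  have [//|[i wi]] := action_cases (act t w).
  have := qval_specialist_le a (state a t w) i.
  by rewrite -wi wq ha leNgt ta.
have wC i : state a t w i <= M / (1 + M).
  by have := wz t; rewrite wc => /zstar_safe.
split => //; apply: le_dist1_to; first exact: pures_nonempty.
move=> _ [i _ <-]; rewrite dist1_pure ler_pdivrMr//.
have := wC i; rewrite ler_pdivlMr// => h; lra.
Qed.

(** The value [0] of [c] ties with that of each specialist, which is reached only at its pure
    worldview; both kinds of outcome remain possible. *)
Lemma critical_outcomes Pi : MPE Pi -> lambda = critical ->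
  {ae law Pi bar, forall (w : path) t,
     (act t w = g None /\ forall i, state bar t w i <= M / (1 + M)) \/
     exists i, act t w = g (Some i) /\ state bar t w = pure R i}.
Proof.
move=> mpe lc.
have qb b x : zstar u b x -> qval u lambda bar b x <= hmax u bar.
  by move=> _; rewrite hmax_bar; apply: qval_le => // i; rewrite specialist_value_bar_eq0.
have q := mpe_ae_qval delta_gt0 delta_lt1 lambda_gt0 lambda_lt1 qb mpe.
apply: filterS2 q (mpe_ae_zstar bar mpe) => w wq wz t.
have := wz t; have := wq t; rewrite hmax_bar.
have [->|[i ->]] := action_cases (act t w); first by move=> _ /zstar_safe; left.
rewrite -(@specialist_value_bar_eq0 i)// => /qval_specialist_eq ->.
by right; exists i.
Qed.

(* The flag mixed sends ties between c and the best specialist to the barycenter. *)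
Lemma measurable_target_choice (mixed : bool) :
  exists tau : worldview R n -> worldview R n, measurable_fun setT tau /\
    forall a, exists i, (forall j, a j <= a i) /\
      tau a = if mixed ==> (0 < specialist_value a i) then pure R i else bar.
Proof.
(* [inl (j, i)] tests [a j <= a i] and thus finds a largest weight; [inr i] tests whether the value
   of specialist [i] is positive. *)
pose F (v : {ffun ('I_n.+1 * 'I_n.+1) + 'I_n.+1 -> bool}) :=
  let i := odflt ord0 [pick i | [forall j, v (inl (j, i))]] in
  if mixed ==> v (inr i) then pure R i else bar.
pose A (k : ('I_n.+1 * 'I_n.+1) + 'I_n.+1) := match k with
  | inl ji => [set a : worldview R n | a ji.1 <= a ji.2]
  | inr i => [set a | 0 < specialist_value a i] end.
exists (fun a => F [ffun k => `[< A k a >]]); split.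
  apply: measurable_finite_tests => -[[j i]|i] /=; rewrite -[X in measurable X]setTI.
    by apply: measurable_fun_le => //; exact: measurable_weight.
  have msv : measurable_fun setT (specialist_value^~ i).
    apply: measurable_funB => //; apply: measurable_funM => //.
    by apply: measurable_funB => //; exact: measurable_weight.
  have /(_ measurableT [set true]) := measurable_fun_ltr (measurable_cst (0 : R)) msv.
  exact.
move=> a.
have [i0 ai0] : exists i, forall j, a j <= a i.
  exists [arg max_(j > ord0) a j]%O => j.
  by case: arg_maxP => // i _; exact.
rewrite /F; case: pickP => [i /forallP h|/(_ i0) /negP[]] /=.
  exists i; split; first by move=> j; have := h j; rewrite ffunE => /asboolP.
  by rewrite ffunE asboolb.
by apply/forallP => j; rewrite ffunE; apply/asboolP; exact: ai0.
Qed.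

(** With [mixed], every [lambda] is allowed. Without it the target is always pure, so the best
    specialist value must be nonnegative at every worldview; [lambda <= critical] ensures this. *)
Lemma target_MPE (mixed : bool) : mixed || (lambda <= critical) ->
  exists2 Pi, MPE Pi & {ae law Pi bar, forall (w : path) t, (1 <= t)%N ->
    state bar t w = state bar 1 w /\
    if mixed ==> (lambda < critical) then pures R n (state bar 1 w)
    else state bar 1 w = bar}.
Proof.
move=> mc; have [phi [mphi phiP]] := measurable_optimal_action u.
have [tau [mtau tauP]] := measurable_target_choice mixed.
have phi_pure i : phi (pure R i) = g (Some i) by apply: zstar_pure_eq.
have phi_bar : phi bar = g None by apply: zstar_bar_eq.
have tau_pure i : tau (pure R i) = pure R i.
  have [k [ki ->]] := tauP (pure R i).
  have -> : k = i.
    apply/eqP/negPn/negP => /negbTE ki'.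
    by have := ki i; rewrite !pureE eqxx ki' ler10.
  by rewrite specialist_value_pure eqxx ltr01 implybT.
(* The largest weight is at least the average [1 / N], so the best specialist value is smallest at
   the barycenter. *)
have sv_bar a i j : (forall k, a k <= a i) -> specialist_value bar j <= specialist_value a i.
  move=> ai; rewrite lerB// ler_wpM2l ?(ltW lM_gt0)// lerB// barycenterE.
  rewrite -(ler_pM2l N_gt0) mulfV ?gt_eqF// mulr_natl -[leLHS](sum_weight a).
  by rewrite -[X in _ *+ X](card_ord n.+1) -sumr_const; apply: ler_sum.
(* In either case the target attains the larger of [0] and the best specialist value, which is the
   bound of [qval_le]. *)
have tau_spec a : (exists2 i, tau a = pure R i &
      0 <= specialist_value a i /\ forall j, a j <= a i) \/
    [/\ mixed, tau a = bar, critical <= lambda & forall i, specialist_value a i <= 0].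
  have [i [ai ->]] := tauP a; case: ifPn => [h|].
    left; exists i => //; split => //.
    case/orP: mc => [m|lc]; first by move: h; rewrite m => /ltW.
    apply: le_trans (sv_bar a i i ai).
    by rewrite leNgt specialist_value_bar_lt0 -leNgt.
  rewrite negb_imply -leNgt => /andP[m sa]; right; split => //.
    rewrite leNgt -(specialist_value_bar_gt0 i) -leNgt.
    exact: le_trans (sv_bar a i i ai) sa.
  move=> j; apply: le_trans sa; rewrite lerB// ler_wpM2l ?(ltW lM_gt0)// lerB//.
have tau_bar : tau bar = if mixed ==> (lambda < critical) then tau bar else bar.
  have [i [_ ->]] := tauP bar.
  by rewrite specialist_value_bar_gt0; case: ifP.
have tau_idem a : tau (tau a) = tau a.
  have [[i -> _]|[m -> cl _]] := tau_spec a; first exact: tau_pure.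
  by rewrite tau_bar m /= ltNge cl.
pose f a : action X * worldview R n := (phi a, tau a).
have mf : measurable_fun setT f by exact: measurable_fun_pair.
exists (deterministic mf).
  apply: (deterministic_MPE delta_gt0 delta_lt1 lambda_gt0 lambda_lt1) => // a b x _ /=.
  have [[i -> [s0 ai]]|[_ -> _ sv0]] := tau_spec a.
    rewrite phi_pure qval_specialist_pure; apply: qval_le => // j.
    by rewrite lerB// ler_wpM2l ?(ltW lM_gt0)// lerB.
  by rewrite phi_bar qval_safe; apply: qval_le.
have := deterministic_state mf tau_idem bar.
apply: filterS => w wt t t1; have [_ ->] := wt t t1; have [_ ->] := wt 1%N isT.
split=> //=; rewrite tau_bar; case h: (mixed ==> _) => //.
have [[i -> _]|[m _ cl _]] := tau_spec bar; first by exists i.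
by move: h; rewrite m /= ltNge cl.
Qed.

End specialists.

(** * Part (B) as the case of two worldviews and [M = 3] *)

Definition actionB_specialty (x : actionB) : option 'I_2 :=
  match x with
  | actB_c => None | actB_a => Some ord0 | actB_b => Some ord_max
  end.

Definition specialtyB_action (o : option 'I_2) : actionB :=
  if o is Some i then (if i == ord0 then actB_a else actB_b) else actB_c.

Lemma actionB_specialtyK : cancel actionB_specialty specialtyB_action.
Proof. by case. Qed.

Lemma specialtyB_actionK : cancel specialtyB_action actionB_specialty.
Proof.
move=> [i|] //=; case: eqP => [->//|/eqP i0] /=; congr Some.
by apply/val_inj; case: i i0 => -[|[|]].
Qed.

Lemma payoffB_C (R : realType) (j : 'I_2) (x : actionB) :
  payoffB R j x = payoffC 3 j (actionB_specialty x).
Proof. by rewrite /payoffB; case: j => -[|[|//]] i; case: x. Qed.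

Lemma criticalB (R : realType) : critical 1 3 = 1 / 2 :> R.
Proof. by rewrite /critical; field. Qed.

(** * Assembly of parts (A), (B) and (C) *)

Theorem theorem9p1 (R : realType) (delta lambda : R)
    (delta_gt0 : 0 < delta) (delta_lt1 : delta < 1)
    (lambda_gt0 : 0 < lambda) (lambda_lt1 : lambda < 1) :
  (* (A) *)
  (forall (n : nat) (X : pfinType) (u : 'I_n.+1 -> X -> R)
      (abar : worldview R n),
    (forall (b : worldview R n) (x : X), zstar u b x ->
       qval u lambda abar b x <= hmax u abar) ->
    (forall Pi : strategy R n X, stationary_MPE u delta lambda Pi ->
       {ae law Pi abar, forall w, forall t : nat, (1 <= t)%N ->
          qval u lambda abar (state abar t w) (act t w) = hmax u abar /\
          Kset u lambda abar (state abar t w)}) /\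
    (Kset u lambda abar `&` pures R n = set0 ->
       0 < dist1_sets (Kset u lambda abar) (pures R n) /\
       forall Pi : strategy R n X, stationary_MPE u delta lambda Pi ->
         {ae law Pi abar, forall w, forall t : nat, (1 <= t)%N ->
            dist1_sets (Kset u lambda abar) (pures R n) <=
              dist1_to (state abar t w) (pures R n)}))
  /\
  (* (B) *)
  (let MPE := @stationary_MPE R 1 actionB (@payoffB R) delta lambda in
   let half : worldview R 1 := barycenter R 1 in
   let p t w : R := state half t w ord0 in
   (exists Pi : strategy R 1 actionB, MPE Pi) /\
   (* (i) *)
   (lambda < 1 / 2 -> forall Pi, MPE Pi ->
      {ae law Pi half, forall w,
         (p 1%N w = 0 \/ p 1%N w = 1) /\
         forall t : nat, (1 <= t)%N -> p t w = p 1%N w}) /\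
   (* (ii) *)
   (lambda = 1 / 2 ->
      (exists2 Pi, MPE Pi &
         {ae law Pi half, forall w,
            (p t w @[t --> \oo] --> (0 : R)) \/
            (p t w @[t --> \oo] --> (1 : R))}) /\
      (exists2 Pi, MPE Pi &
         {ae law Pi half, forall w,
            ~ ((p t w @[t --> \oo] --> (0 : R)) \/
               (p t w @[t --> \oo] --> (1 : R)))}) /\
      (forall Pi, MPE Pi ->
         {ae law Pi half, forall w, forall t : nat, (1 <= t)%N ->
            [\/ 1 / 4 <= p t w <= 3 / 4 /\ act t w = actB_c,
                p t w = 1 /\ act t w = actB_a |
                p t w = 0 /\ act t w = actB_b]})) /\
   (* (iii) *)
   (1 / 2 < lambda -> forall Pi, MPE Pi ->
      {ae law Pi half, forall w, forall t : nat,
         act t w = actB_c /\ 1 / 4 <= p t w <= 3 / 4} /\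
      {ae law Pi half, forall w, forall t : nat,
         1 / 4 <= inf [set `|p t w - e| | e in [set 0; 1]]}))
  /\
  (* (C): N = n.+1 pure worldviews *)
  (forall (n : nat) (M : R),
    let N : R := n.+1%:R in
    (2 <= n.+1)%N -> 1 / (N - 1) < M ->
    let X : pfinType := option 'I_n.+1 in
    let MPE := @stationary_MPE R n X (payoffC M) delta lambda in
    let abar : worldview R n := barycenter R n in
    let lambda_c := N / ((N - 1) * (1 + M)) in
    let Cc := [set a : worldview R n | forall i, a i <= M / (1 + M)] in
    let T := [set a : worldview R n |
                sup (range (weight a)) < 1 - 1 / (lambda * (1 + M))] in
    let stays_in_c (Pi : strategy R n X) (a : worldview R n) :=
      {ae law Pi a, forall w, forall t : nat,
         [/\ act t w = None, Cc (state a t w) &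
             2 / (1 + M) <= dist1_to (state a t w) (pures R n)]} in
    [/\ (exists Pi : strategy R n X, MPE Pi) /\
        (forall Pi : strategy R n X, MPE Pi ->
           forall j : 'I_n.+1,
             state_marginal Pi (pure R j) [set pure R j] = 1%E),
        (* (i) *)
        lambda < lambda_c -> forall Pi : strategy R n X, MPE Pi ->
          {ae law Pi abar, forall w,
             pures R n (state abar 1 w) /\
             forall t : nat, (1 <= t)%N -> state abar t w = state abar 1 w},
        (* (ii) *)
        lambda_c < lambda ->
          [/\ T !=set0, open T &
              forall Pi : strategy R n X, MPE Pi ->
                stays_in_c Pi abar /\ forall a, T a -> stays_in_c Pi a] &
        (* (iii) *)
        lambda = lambda_c ->
          (exists2 Pi : strategy R n X, MPE Pi &
             {ae law Pi abar, forall w,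
                pures R n (state abar 1 w) /\
                forall t : nat, (1 <= t)%N ->
                  state abar t w = state abar 1 w}) /\
          (exists2 Pi : strategy R n X, MPE Pi &
             {ae law Pi abar, forall w,
                ~ pures R n (state abar 1 w) /\
                forall t : nat, (1 <= t)%N ->
                  state abar t w = state abar 1 w})]).
Proof.
split; [|split].
- move=> n X u abar qh; split=> [Pi mpe|KP].
    have q := mpe_ae_qval delta_gt0 delta_lt1 lambda_gt0 lambda_lt1 qh mpe.
    apply: filterS2 q (mpe_ae_zstar abar mpe) => w wq wz t _; split; first exact: wq.
    by exists (act t w); [exact: wz|exact: wq].
  split; first exact: dist1_Kset_pures_gt0.
  move=> Pi mpe.
  have q := mpe_ae_qval delta_gt0 delta_lt1 lambda_gt0 lambda_lt1 qh mpe.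
  apply: filterS2 q (mpe_ae_zstar abar mpe) => w wq wz t _.
  apply: dist1_sets_le_to; last exact: pures_nonempty.
  by exists (act t w); [exact: wz|exact: wq].
- move=> MPE half p.
  have M0 : (0 : R) < 3 by [].
  have NM : (1 + 3 : R) < 2%:R * 3 by lra.
  have pure_p a : pures R 1 a -> a ord0 = 0 \/ a ord0 = 1 :> R.
    move=> [i _ <-]; rewrite pureE; case: (_ == _); [by right|by left].
  have range_p (a : worldview R 1) : (forall i, a i <= 3 / (1 + 3)) ->
      1 / 4 <= a ord0 <= 3 / 4.
    have -> : 1 + 3 = 4 :> R by ring.
    (* The weights sum to one, so the upper bound on the second is the lower bound on the first. *)
    move=> h; have := h ord0; have := h ord_max.
    have := sum_weight a; rewrite big_ord_recl big_ord1.
    rewrite (_ : lift ord0 ord0 = ord_max); last exact/val_inj.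
    by move=> *; apply/andP; split; lra.
  have ex mixed := target_MPE actionB_specialtyK specialtyB_actionK (@payoffB_C R)
    delta_gt0 delta_lt1 lambda_gt0 lambda_lt1 M0 NM (mixed := mixed).
  rewrite criticalB in ex.
  split; first by have [Pi mpe _] := ex true isT; exists Pi.
  split.
    move=> lc Pi mpe.
    rewrite -criticalB in lc.
    have := subcritical_becomes_pure actionB_specialtyK specialtyB_actionK
      (@payoffB_C R) delta_gt0 delta_lt1 lambda_gt0 lambda_lt1 M0 NM mpe lc.
    apply: filterS => w [w1 wt]; split; first exact: pure_p.
    by move=> t t1; rewrite /p wt.
  split.
    move=> lc; split; [|split].
    (* Ties go to pure worldviews: from period [1] on the path is constant at [0] or [1]. *)
    + have [|Pi mpe h] := ex false; first by rewrite lc lexx.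
      exists Pi => //; apply: filterS h => w h.
      have p1 t : (1 <= t)%N -> p t w = p 1%N w by move=> /h[]; rewrite /p => ->.
      have pc : p t w @[t --> \oo] --> p 1%N w.
        by apply: cvg_near_cst; exists 1%N => // t /= /p1.
      have pE : p 1%N w = 0 \/ p 1%N w = 1 by have [_ /pure_p] := h 1%N isT.
      by case: pE pc => ->; [left|right].
    (* Ties go to the barycenter: the path is constant at [1 / 2], and limits are unique. *)
    + have [//|Pi mpe h] := ex true.
      exists Pi => //; apply: filterS h => w h.
      have p1 t : (1 <= t)%N -> p t w = p 1%N w by move=> /h[]; rewrite /p => ->.
      have pc : p t w @[t --> \oo] --> p 1%N w.
        by apply: cvg_near_cst; exists 1%N => // t /= /p1.
      have e : state half 1 w = half by have [_] := h 1%N isT; rewrite lc ltxx.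
      have pE : p 1%N w = 2^-1 by rewrite /p e barycenterE.
      rewrite pE in pc.
      have neq (x : R) : x <> 2^-1 -> ~ (p t w @[t --> \oo] --> x).
        by move=> x2 px; apply: x2; exact: (cvg_unique _ px pc).
      by case; apply: neq; lra.
    + move=> Pi mpe; rewrite -criticalB in lc.
      have := critical_outcomes actionB_specialtyK specialtyB_actionK
        (@payoffB_C R) delta_gt0 delta_lt1 lambda_gt0 lambda_lt1 M0 NM mpe lc.
      apply: filterS => w wt t _; rewrite /p.
      have [[-> /range_p ?]|[i [-> ->]]] := wt t; first exact: Or31.
      by rewrite pureE /=; case: eqVneq => _; [exact: Or32|exact: Or33].
  move=> lc Pi mpe.
  rewrite -criticalB in lc.
  have trapB := trap_bar lambda_gt0 M0 NM lc.
  have h : {ae law Pi half, forall w, forall t : nat,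
      act t w = actB_c /\ 1 / 4 <= p t w <= 3 / 4}.
    have := trap_stays_safe actionB_specialtyK specialtyB_actionK
      (@payoffB_C R) delta_gt0 delta_lt1 lambda_gt0 lambda_lt1 M0 mpe trapB.
    by apply: filterS => w wt t; have [-> /range_p ? _] := wt t.
  split=> //; apply: filterS h => w h t; have [_ /andP[p1 p2]] := h t.
  apply: lb_le_inf; first by exists `|p t w - 0|, 0 => //; left.
  move=> _ [z [] -> <-].
    by rewrite subr0 ger0_norm; lra.
  by rewrite ler0_norm; lra.
- move=> n M N n1 NM X MPE abar lambda_c Cc T stays_in_c.
  have N0 : 0 < N - 1 by rewrite subr_gt0 ltr1n.
  have M0 : 0 < M by apply: lt_trans NM; rewrite divr_gt0.
  have {}NM : 1 + M < n.+1%:R * M.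
    by move: NM; rewrite ltr_pdivrMr// -/N => NM; lra.
  have idK : cancel id (id : option 'I_n.+1 -> option 'I_n.+1) by [].
  have uE (j : 'I_n.+1) (x : X) : payoffC M j x = payoffC M j (id x) by [].
  have ex mixed := target_MPE idK idK uE delta_gt0 delta_lt1 lambda_gt0 lambda_lt1
    M0 NM (mixed := mixed).
  split.
  + split; first by have [Pi mpe _] := ex true isT; exists Pi.
    move=> Pi mpe j.
    exact: (pure_absorbing idK idK uE delta_gt0 delta_lt1 lambda_gt0 lambda_lt1 M0 j mpe).
  + move=> lc Pi mpe.
    exact: (subcritical_becomes_pure idK idK uE delta_gt0 delta_lt1 lambda_gt0 lambda_lt1
      M0 NM mpe lc).
  + move=> lc.
    have tbar := trap_bar lambda_gt0 M0 NM lc.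
    split; [by exists abar|exact: open_weight_lt|move=> Pi mpe].
    have st a : T a -> stays_in_c Pi a.
      exact: (trap_stays_safe idK idK uE delta_gt0 delta_lt1 lambda_gt0 lambda_lt1 M0 mpe).
    by split=> //; exact: st.
  + move=> lc; split.
      have [|Pi mpe h] := ex false; first by rewrite lc lexx.
      exists Pi => //; apply: filterS h => w h; split=> [|t t1]; first by have [] := h 1%N isT.
      by have [] := h t t1.
    have [//|Pi mpe h] := ex true.
    exists Pi => //; apply: filterS h => w h; split=> [|t t1]; last by have [] := h t t1.
    have lcF : (lambda < critical n M) = false by rewrite lc ltxx.
    have e : state abar 1 w = abar by have [_] := h 1%N isT; rewrite lcF.
    (* A pure worldview has a weight equal to [1], whereas all weights of the barycenter are [1 / N]
       with [N >= 2]. *)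
    rewrite e => -[i _] /(congr1 (fun a => weight a i)).
    rewrite pureE eqxx barycenterE => /eqP; rewrite eq_sym invr_eq1 pnatr_eq1 => /eqP n0.
    by rewrite n0 in n1.
Qed.
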